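(* Let $d$ be a positive integer and let $(T,o)$ be a unimodular random rooted tree with all vertex degrees at most $d$ almost surely. Assume that almost surely $$\limsup_{n\to\infty}|B_T(o,n)|^{1/n} > \sqrt{d-1}.$$ Then almost surely the limit $$\lim_{n\to\infty}|B_T(o,n)|^{1/n}$$ exists.
   Context: For a connected rooted graph $(G,o)$ of bounded degree, $B_G(o,n)$ denotes the set of vertices at graph distance at most $n$ from $o$. The space $\mathcal G_d$ of isomorphism classes of connected rooted graphs with degrees at most $d$ carries the metric in which two rooted graphs are at distance $\inf \frac1{k+1}$ over all $k$ such that their $k$-balls around the roots are isomorphic as rooted graphs. A random rooted graph $(G,o)$ is a random element of $\mathcal G_d$. It is unimodular if it satisfies the Mass Transport Principle: for every measurable non-negative function $F$ on (isomorphism classes of) triples $(G,x,y)$, with $G$ a bounded degree connected graph and $x,y\in V(G)$, $$\mathbb E\Big(\sum_{x\in V(G)}F(G,o,x)\Big)=\mathbb E\Big(\sum_{x\in V(G)}F(G,x,o)\Big),$$ provided one of the sides is finite. A unimodular random rooted tree is a unimodular random rooted graph that is almost surely a tree. *)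

(* Defs.v *)
From HB Require Import structures.
From mathcomp Require Import all_boot all_order all_algebra generic_quotient.
From mathcomp Require Import finmap.
From mathcomp Require Import all_classical all_reals all_analysis measurable_realfun.

Set Implicit Arguments.
Unset Strict Implicit.
Unset Printing Implicit Defensive.

Import Order.TTheory GRing.Theory Num.Theory.
Import numFieldNormedType.Exports.

Local Open Scope classical_set_scope.
Local Open Scope card_scope.
Local Open Scope ring_scope.
Local Open Scope quotient_scope.

(* Simple connected graphs of bounded degree. Such a graph has countably many *)
(* vertices, so taking the vertices in nat loses nothing up to isomorphism.   *)
Record graph := Graph {
  vset : pred nat;
  adj : rel {x : nat | vset x};
  adj_sym : symmetric adj;
  adj_irr : irreflexive adj;
  adj_conn : forall x y, exists2 p, path adj x p & y = last x p;
  adj_bdd : exists D, forall x, [set y | adj x y] #<= `I_D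
}.

Notation vertex G := {x : nat | vset G x}.

Definition degree_le (G : graph) (d : nat) : Prop :=
  forall x : vertex G, [set y | adj x y] #<= `I_d.

(* Simple cycles have length at least 3: uniq [cycle adj] sequences of length *)
(* 0 and 2 are the empty sequence and a single edge traversed back and forth. *)
Definition is_tree (G : graph) : Prop :=
  forall c : seq (vertex G), cycle (@adj G) c -> uniq c -> (size c <= 2)%N.

Definition vball (G : graph) (x : vertex G) (k : nat) : set (vertex G) :=
  [set y | exists p, [/\ path (@adj G) x p, last x p = y & (size p <= k)%N]].

(* Graphs with an ordered (m+1)-tuple of roots: m = 0 gives the rooted graphs *)
(* (G, o) and m = 1 the triples (G, x, y).                                    *)
Record mgraph (m : nat) := MGraph {
  mgraph_graph :> graph;
  roots : m.+1.-tuple (vertex mgraph_graph)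
}.

Definition root (G : mgraph 0) : vertex G := thead (roots G).

Definition birooted (G : graph) (x y : vertex G) : mgraph 1 :=
  MGraph [tuple x; y].

Definition iso m (G H : mgraph m) : Prop :=
  exists f : vertex G -> vertex H,
    [/\ bijective f, {mono f : x y / adj x y} & map f (roots G) = roots H].

(* The k-ball of a triple (G, x, y) is the union of those around x and y; the *)
(* resulting distance induces the usual local topology on triples.            *)
Definition rball m (G : mgraph m) (k : nat) : set (vertex G) :=
  \bigcup_(r in [set` roots G]) vball r k.

Arguments rball {m} G k _.

(* Only the values of f on rball G k matter. *)
Definition ball_iso m (k : nat) (G H : mgraph m) : Prop :=
  exists f : vertex G -> vertex H,
    [/\ set_bij (rball G k) (rball H k) f,
        {in rball G k &, {mono f : x y / adj x y}} &
        map f (roots G) = roots H].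

Lemma vball0 (G : graph) (x : vertex G) k : vball x k x.
Proof. by exists [::]. Qed.

Lemma vballS (G : graph) (x : vertex G) k :
  vball x k.+1 `<=` vball x k `|` \bigcup_(y in vball x k) [set z | adj y z].
Proof.
move=> z [p [+ + +]]; elim/last_ind: p z => [|p a _] z.
  by move=> _ /= <- _; left; exact: vball0.
rewrite rcons_path last_rcons size_rcons ltnS => /andP[xp pa] <- pk.
by right; exists (last x p) => //; exists p.
Qed.

Lemma finite_vball (G : graph) (x : vertex G) k : finite_set (vball x k).
Proof.
have [D hD] := adj_bdd G.
elim: k => [|k IH].
  apply: (@sub_finite_set _ _ [set x]); last exact: finite_set1.
  by move=> y [[|a p] [_ /= <-]].
apply: (sub_finite_set (@vballS G x k)).
rewrite finite_setU; split => //; apply: bigcup_finite => // y _.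
exact: card_le_finite (hD y) (finite_II D).
Qed.

Section balls.
Variable m : nat.
Implicit Types (G H K : mgraph m) (k : nat).

Lemma finite_rball G k : finite_set (rball G k).
Proof.
by apply: bigcup_finite => [|r _]; [exact: finite_seq|exact: finite_vball].
Qed.

Lemma rball_root G k r : r \in tval (roots G) -> rball G k r.
Proof. by move=> rG; exists r => //; exact: vball0. Qed.

Lemma rball_le G j k : (j <= k)%N -> rball G j `<=` rball G k.
Proof.
move=> jk y [r rG [p [rp py pj]]]; exists r => //; exists p; split => //.
exact: leq_trans pj jk.
Qed.

Lemma rball_path G k r p : r \in tval (roots G) -> path (@adj G) r p ->
  (size p <= k)%N -> forall y, y \in r :: p -> rball G k y.
Proof.
move=> rG rp pk y yp; case/splitPl: yp rp pk => p1 p2 <-.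
rewrite cat_path size_cat => /andP[rp1 _] pk.
by exists r => //; exists p1; split => //; exact: leq_trans (leq_addr _ _) pk.
Qed.

Lemma rball_cover G (x : vertex G) : exists k, rball G k x.
Proof.
have [p rp xp] := adj_conn (thead (roots G)) x.
exists (size p), (thead (roots G)); last by exists p.
exact: mem_tnth.
Qed.

Lemma rball_homo G H k j (f : vertex G -> vertex H) :
  {in rball G k &, {mono f : x y / adj x y}} -> map f (roots G) = roots H ->
  (j <= k)%N -> forall x, rball G j x -> rball H j (f x).
Proof.
move=> fadj fr jk _ [r rG [p [rp <- pj]]].
exists (f r).
  by change (f r \in tval (roots H)); rewrite -fr; exact: map_f.
exists (map f p); split; [|by rewrite last_map|by rewrite size_map].
have pB := rball_path rG rp (leq_trans pj jk).
rewrite path_map; apply: (@sub_in_path _ (mem (rball G k)) (@adj G)) _ rp.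
  by move=> x y xB yB; rewrite /= fadj.
by apply/allP => y yp; rewrite /= inE; exact: pB.
Qed.

Lemma ball_iso_inv G H k (f : vertex G -> vertex H) :
  set_bij (rball G k) (rball H k) f ->
  {in rball G k &, {mono f : x y / adj x y}} -> map f (roots G) = roots H ->
  exists g : vertex H -> vertex G,
    [/\ set_bij (rball H k) (rball G k) g,
        {in rball H k &, {mono g : x y / adj x y}},
        map g (roots H) = roots G,
        {in rball G k, cancel f g} & {in rball H k, cancel g f}].
Proof.
move=> [fB finj fsurj] fadj fr.
have /choice[g hg] : forall y, exists x, rball H k y -> rball G k x /\ f x = y.
  move=> y; have [yB|nyB] := pselect (rball H k y).
    by have [x xB <-] := fsurj _ yB; exists x.
  by exists (thead (roots G)).
have fK : {in rball G k, cancel f g}.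
  move=> x /set_mem xB; have [gB fg] := hg _ (fB _ xB).
  by apply: finj => //; exact/mem_set.
have gK : {in rball H k, cancel g f} by move=> y /set_mem /hg[].
exists g; split => //.
- split.
  + by move=> y /hg[].
  + by move=> y z yB zB e; rewrite -(gK y yB) -(gK z zB) e.
  + by move=> x xB; exists (f x); [exact: fB|apply: fK; exact/mem_set].
- move=> y z /set_mem yB /set_mem zB.
  have [gyB {2}<-] := hg _ yB; have [gzB {2}<-] := hg _ zB.
  by rewrite fadj //; exact/mem_set.
- rewrite -fr -map_comp -[RHS]map_id; apply/eq_in_map => x xr /=.
  by apply: fK; apply/mem_set/rball_root.
Qed.

Lemma ball_iso_refl k G : ball_iso k G G.
Proof.
exists id; split => //; last by rewrite map_id.
by split => // y yB; exists y.
Qed.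

Lemma ball_iso_sym k G H : ball_iso k G H -> ball_iso k H G.
Proof.
move=> [f [fbij fadj fr]].
by have [g [? ? ? _ _]] := ball_iso_inv fbij fadj fr; exists g.
Qed.

Lemma ball_iso_trans k H G K :
  ball_iso k G H -> ball_iso k H K -> ball_iso k G K.
Proof.
move=> [f [[fB finj fsurj] fadj fr]] [g [[gB ginj gsurj] gadj gr]].
have fB' x : x \in rball G k -> f x \in rball H k.
  by move=> /set_mem/fB/mem_set.
exists (g \o f); split.
- split.
  + by move=> x /fB/gB.
  + by move=> x y xB yB /= /ginj e; apply: finj => //; apply: e; exact: fB'.
  + by move=> z /gsurj[y /fsurj[x xB <-] <-]; exists x.
- by move=> x y xB yB /=; rewrite gadj ?fadj //; exact: fB'.
- by rewrite map_comp fr gr.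
Qed.

Lemma ball_iso_le j k G H : (j <= k)%N -> ball_iso k G H -> ball_iso j G H.
Proof.
move=> jk [f [fbij fadj fr]].
have [g [gbij gadj gr fK gK]] := ball_iso_inv fbij fadj fr.
have jkG x : x \in rball G j -> x \in rball G k.
  by move=> /set_mem/(rball_le jk)/mem_set.
have jkH x : x \in rball H j -> x \in rball H k.
  by move=> /set_mem/(rball_le jk)/mem_set.
exists f; split => //.
- split.
  + by move=> x; exact: rball_homo fadj fr jk _.
  + move=> x y /jkG xB /jkG yB e.
    by rewrite -(fK x xB) -(fK y yB) e.
  + move=> y yB; exists (g y); first exact: rball_homo gadj gr jk _ yB.
    by apply/gK/jkH/mem_set.
- by move=> x y /jkG xB /jkG yB; exact: fadj.
Qed.

Lemma iso_ball_iso G H : iso G H -> forall k, ball_iso k G H.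
Proof.
move=> [f [[g fK gK] fadj fr]] k.
have gadj : {mono g : x y / adj x y} by move=> x y; rewrite -fadj !gK.
have gr : map g (roots H) = roots G.
  by rewrite -fr -map_comp (eq_map fK) map_id.
exists f; split=> //.
- split.
  + by move=> x; apply: rball_homo fr (leqnn k) _ => ? ? _ _.
  + by move=> x y _ _ /(can_inj fK).
  + move=> y yB; exists (g y); last exact: gK.
    by apply: rball_homo gr (leqnn k) _ yB => ? ? _ _.
Qed.

Lemma iso_refl G : iso G G.
Proof. by exists id; split => //; [exists id|rewrite map_id]. Qed.

Lemma iso_sym G H : iso G H -> iso H G.
Proof.
move=> [f [[g fK gK] fadj fr]]; exists g; split; first by exists f.
- by move=> x y; rewrite -fadj !gK.
- by rewrite -fr -map_comp (eq_map fK) map_id.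
Qed.

Lemma iso_trans H G K : iso G H -> iso H K -> iso G K.
Proof.
move=> [f [fbij fadj fr]] [g [gbij gadj gr]]; exists (g \o f); split.
- exact: bij_comp.
- by move=> x y /=; rewrite gadj fadj.
- by rewrite map_comp fr gr.
Qed.

Lemma ultra_value (U : set_system nat) (T : choiceType) (B : set T)
    (f : nat -> T) : UltraFilter U -> finite_set B ->
  (\forall k \near U, B (f k)) -> exists y, \forall k \near U, f k = y.
Proof.
move=> UU /finite_seqP[s ->]; elim: s => [|a s IH].
  by move=> /filter_ex [].
move=> hs; have [ha|ha] := in_ultra_setVsetC [set k | f k = a] UU.
  by exists a.
apply: IH; near=> k.
have : f k \in a :: s by near: k.
rewrite /= inE => /orP[/eqP fa|//].
by have : ~ (f k = a) by near: k.
Unshelve. all: by end_near. Qed.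

(* The isomorphism is an ultralimit of the isomorphisms between k-balls.      *)
Lemma ball_iso_iso G H : (forall k, ball_iso k G H) -> iso G H.
Proof.
move=> /choice[f hf].
have /choice[g hg] : forall k, exists g : vertex H -> vertex G,
    [/\ set_bij (rball H k) (rball G k) g,
        {in rball H k &, {mono g : x y / adj x y}},
        map g (roots H) = roots G,
        {in rball G k, cancel (f k) g} & {in rball H k, cancel g (f k)}].
  by move=> k; have [? ? ?] := hf k; exact: ball_iso_inv.
have [U [UU leU]] := @ultraFilterLemma nat \oo _.
have nearB (K : mgraph m) (x : vertex K) : \forall k \near U, rball K k x.
  have [n xn] := rball_cover x; apply: leU; exists n => // k /= nk.
  exact: rball_le xn.
have /choice[F hF] : forall x, exists y, \forall k \near U, f k x = y.
  move=> x; have [n xn] := rball_cover x.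
  apply: (@ultra_value _ _ (rball H n)); first exact: finite_rball.
  apply: leU; exists n => // k /= nk; have [_ fadj fr] := hf k.
  exact: rball_homo fadj fr nk _ xn.
have /choice[F' hF'] : forall y, exists x, \forall k \near U, g k y = x.
  move=> y; have [n yn] := rball_cover y.
  apply: (@ultra_value _ _ (rball G n)); first exact: finite_rball.
  apply: leU; exists n => // k /= nk; have [_ gadj gr _ _] := hg k.
  exact: rball_homo gadj gr nk _ yn.
have FK : cancel F F'.
  move=> x; have [k [[xB fk] gk]] :=
    filter_ex (filterI (filterI (nearB G x) (hF x)) (hF' (F x))).
  by have [_ _ _ + _] := hg k; rewrite -gk -fk; apply; exact/mem_set.
have F'K : cancel F' F.
  move=> y; have [k [[yB gk] fk]] :=
    filter_ex (filterI (filterI (nearB H y) (hF' y)) (hF (F' y))).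
  by have [_ _ _ _] := hg k; rewrite -fk -gk; apply; exact/mem_set.
exists F; split; first by exists F'.
- move=> x y.
  have [k [[xB fx] [yB fy]]] :=
    filter_ex (filterI (filterI (nearB G x) (hF x)) (filterI (nearB G y) (hF y))).
  by have [_ fadj _] := hf k; rewrite -fx -fy fadj //; exact/mem_set.
- have /filter_ex[k hk] : \forall k \near U,
      {in tval (roots G), forall r, f k r = F r}.
    elim: (tval (roots G)) => [|r s IH]; first exact: nearW.
    apply: filterS (filterI (hF r) IH) => k [hr hs] t.
    by rewrite inE => /orP[/eqP -> //|]; exact: hs.
  by have [_ _ <-] := hf k; apply/eq_in_map => r /hk ->.
Qed.

End balls.

HB.instance Definition _ m := gen_eqMixin (mgraph m).
HB.instance Definition _ m := gen_choiceMixin (mgraph m).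

Definition isob m : rel (mgraph m) := fun G H => `[< iso G H >].

Lemma isob_refl m : reflexive (@isob m).
Proof. by move=> G; apply/asboolP/iso_refl. Qed.

Lemma isob_sym m : symmetric (@isob m).
Proof. by move=> G H; apply/asboolP/asboolP; exact: iso_sym. Qed.

Lemma isob_trans m : transitive (@isob m).
Proof.
by move=> H G K /asboolP GH /asboolP HK; apply/asboolP/(iso_trans GH HK).
Qed.

Canonical isob_equiv m :=
  EquivRel (@isob m) (@isob_refl m) (@isob_sym m) (@isob_trans m).

(* R, the field in which distances are measured, is a phantom parameter. *)
Definition gspace (R : realType) (m : nat) := {eq_quot (@isob m)}.

HB.instance Definition _ R m := Choice.on (gspace R m).
HB.instance Definition _ R m := EqQuotient.on (gspace R m).

Definition point_graph : graph.
Proof.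
exists (pred1 0%N) (fun _ _ => false) => //.
  by move=> x y; exists [::] => //; apply/val_inj; case: x y => x + [y];
    rewrite /= => /eqP -> /eqP ->.
by exists 0%N => x; rewrite [X in X #<= _](_ : _ = set0) ?card_le0x //;
  apply/seteqP; split.
Defined.

HB.instance Definition _ R m := isPointed.Build (gspace R m)
  (\pi_(gspace R m)
     (@MGraph m point_graph 
        [tuple of nseq m.+1 (exist (vset point_graph) 0%N (eqxx 0%N))])).

Section metric.
Variables (R : realType) (m : nat).
Implicit Types x y z : gspace R m.

(* The term 1 plays no role for rooted graphs (see gdist_rooted); it caps the *)
(* distance of two triples whose 0-balls {x, y} are already not isomorphic.   *)
Definition gdist_set x y : set R :=
  1 |` [set k.+1%:R^-1 | k in [set k | ball_iso k (repr x) (repr y)]].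

Definition gdist x y : R := inf (gdist_set x y).

Lemma gdist_set_ge0 x y : lbound (gdist_set x y) 0.
Proof. by move=> _ [->//|[k _ <-]]; rewrite invr_ge0. Qed.

Lemma has_inf_gdist x y : has_inf (gdist_set x y).
Proof. by split; [exists 1; left|exists 0; exact: gdist_set_ge0]. Qed.

Lemma gdist_ge0 x y : 0 <= gdist x y.
Proof.
by apply: lb_le_inf; [exists 1; left|exact: gdist_set_ge0].
Qed.

Lemma gdist_le x y a : gdist_set x y a -> gdist x y <= a.
Proof. by move=> xya; apply: ge_inf => //; exists 0; exact: gdist_set_ge0. Qed.

Lemma gdistxx x : gdist x x = 0.
Proof.
apply/eqP; rewrite eq_le gdist_ge0 andbT.
apply/ler_addgt0Pr => e e0; rewrite add0r.
have [k ke] := ltr_add_invr e0; rewrite add0r in ke.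
apply: le_trans (ltW ke); apply: gdist_le; right; exists k => //.
exact: ball_iso_refl.
Qed.

Lemma gdist_sym x y : gdist x y = gdist y x.
Proof.
suff h u v : gdist_set u v `<=` gdist_set v u.
  by rewrite /gdist; congr inf; apply/seteqP; split; exact: h.
by move=> a [->|[k /ball_iso_sym uv <-]]; [left|right; exists k].
Qed.

Lemma gdist_triangle y x z : gdist x z <= gdist x y + gdist y z.
Proof.
rewrite -lerBlDr; apply: lb_le_inf; first by exists 1; left.
move=> a xya; rewrite lerBlDr -lerBlDl.
apply: lb_le_inf; first by exists 1; left.
move=> b yzb; rewrite lerBlDl.
have a0 := gdist_set_ge0 xya; have b0 := gdist_set_ge0 yzb.
have le1 : gdist x z <= 1 by apply: gdist_le; left.
case: xya a0 => [->|[i xy <-] a0]; first by move=> _; rewrite ler_wpDr.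
case: yzb b0 => [->|[j yz <-] b0]; first by move=> _; rewrite ler_wpDl.
wlog ij : x y z i j xy yz a0 b0 {le1} / (i <= j)%N.
  move=> h; have [ij|/ltnW ji] := leqP i j; first exact: (h x y z).
  rewrite gdist_sym addrC; apply: (h z y x) => //; exact: ball_iso_sym.
apply: (@le_trans _ _ (i.+1%:R^-1)); last by rewrite lerDl.
apply: gdist_le; right; exists i => //.
exact: ball_iso_trans xy (ball_iso_le ij yz).
Qed.

Lemma gdist_positivity x y : gdist x y = 0 -> x = y.
Proof.
move=> xy0; rewrite -[x]reprK -[y]reprK; apply/eqmodP/asboolP.
apply: ball_iso_iso => k.
have [a xya] : exists2 a, gdist_set x y a & a < k.+1%:R^-1.
  have k0 : 0 < k.+1%:R^-1 :> R by rewrite invr_gt0.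
  have [a ? +] := inf_adherent k0 (has_inf_gdist x y).
  by rewrite -/(gdist x y) xy0 add0r; exists a.
case: xya => [->|[j xy <-]].
  by rewrite ltNge invf_le1 ?ler1n.
rewrite ltf_pV2 ?posrE // ltr_nat ltnS => /ltnW kj.
exact: ball_iso_le kj xy.
Qed.

HB.instance Definition _ := @isMetric.Build R (gspace R m) gdist
  gdistxx gdist_positivity gdist_sym gdist_triangle.

End metric.

Lemma gdist_rooted (R : realType) (x y : gspace R 0) :
  gdist x y =
  inf [set (k.+1%:R^-1 : R) | k in [set k | ball_iso k (repr x) (repr y)]].
Proof.
congr inf; apply/seteqP; split => [a|a ?]; last by right.
move=> [->|//]; exists 0%N; last by rewrite invr1.
have roots0 (G : mgraph 0) : tval (roots G) = [:: root G].
  by rewrite /root; case: (tupleP (roots G)) => a0 t; rewrite (tuple0 t) theadE.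
have ball0 (G : mgraph 0) : rball G 0 = [set root G].
  apply/seteqP; split => [v [r rG [[|u p] [_ <- pk]]]|_ ->] //=.
    have : r \in tval (roots G) by [].
    by rewrite roots0 inE => /eqP.
  by apply: rball_root; exact: mem_tnth.
exists (fun=> root (repr y)); split.
- rewrite !ball0; split => //.
    by move=> u v /set_mem -> /set_mem ->.
  by move=> _ ->; exists (root (repr x)).
- by rewrite ball0 => u v /set_mem -> /set_mem ->; rewrite !adj_irr.
- by rewrite !roots0.
Qed.

Definition borel (T : ptopologicalType) := g_sigma_algebraType (@open T).
HB.instance Definition _ (T : ptopologicalType) := Measurable.on (borel T).


Notation rooted_graphs R := (gspace R 0).
Notation birooted_graphs R := (gspace R 1).

(* Everything below evaluates at a representative of the isomorphism class a  *)
(* quantity that is invariant under isomorphism of rooted graphs.             *)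
Definition rep (R : realType) (g : borel (rooted_graphs R)) : mgraph 0 :=
  repr (g : rooted_graphs R).

Section unimodular.
Variables (R : realType) (dsp : measure_display) (Omega : measurableType dsp).
Variable P : probability Omega R.
Implicit Types (F : borel (birooted_graphs R) -> \bar R).
Implicit Types (g : borel (rooted_graphs R)).
Local Open Scope ereal_scope.

Definition mass_out F g : \bar R :=
  \esum_(x in [set: vertex (rep g)])
    F (\pi_(birooted_graphs R) (birooted (root (rep g)) x)).

Definition mass_in F g : \bar R :=
  \esum_(x in [set: vertex (rep g)])
    F (\pi_(birooted_graphs R) (birooted x (root (rep g)))).

Definition unimodular (X : {RV P >-> borel (rooted_graphs R)}) : Prop :=
  forall F, measurable_fun setT F -> (forall t, 0 <= F t) ->
    \int[P]_w mass_out F (X w) < +oo \/ \int[P]_w mass_in F (X w) < +oo ->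
    \int[P]_w mass_out F (X w) = \int[P]_w mass_in F (X w).

End unimodular.

Definition growth (R : realType) (G : mgraph 0) (n : nat) : R :=
  #|` fset_set (vball (root G) n)|%:R `^ n%:R^-1.

(* Main.v *)
Require Import Defs.
From HB Require Import structures.
From mathcomp Require Import all_boot all_order all_algebra generic_quotient.
From mathcomp Require Import finmap.
From mathcomp Require Import all_classical all_reals all_analysis measurable_realfun.
From mathcomp Require Import lra zify.

Set Implicit Arguments.
Unset Strict Implicit.
Unset Printing Implicit Defensive.

Import Order.TTheory GRing.Theory Num.Theory.
Import numFieldNormedType.Exports.

Local Open Scope classical_set_scope.
Local Open Scope ring_scope.
Local Open Scope quotient_scope.

(** Let [q = d - 1], or [q = 1] if [d = 1], let [o] be the root, and weight a
    vertex at distance [m] from [o] by [q ^ (- m / 2)]. Let [U n] be the sum of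
    the weights over the ball of radius [n]. Almost surely [ln (U n) / n]
    converges; above the threshold [sqrt (d - 1)] for the upper growth rate
    the limit is positive and carries over to the ball sizes.

    Write [K n] for the symmetric kernel [q ^ (- dist x y / 2)], cut off at
    distance [n], so that [U n] is [K n] applied to 1 ([ball_sum]). In a tree
    of degree at most [q + 1] the product of [K n] and [K m] is at most a
    polynomial times [K (n + m)] ([ball_sum_kernel]): a vertex [y] branches off
    the geodesic from [x] to [z] at some vertex [c], there are at most
    [2 * q ^ j] vertices at distance [j] from [c], and this is what the weights
    of the detour from [c] to [y] and back compensate. Hence the square and
    the cube of [K n], applied to 1, are bounded by [U (2 * n)] and
    [U (3 * n)], up to polynomial factors.

    Conversely, unimodularity bounds these powers from below by the powers of
    [U n]. Put [f1 = U n], [f2 = K n f1] and [f3 = K n f2], as functions of the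
    root. By Jensen's inequality [f1 ^ 2 / f2] is at most [K n (1 / f1)], whose
    expectation equals that of [f1 / f1 = 1] by the Mass Transport Principle.
    In the same way [sqrt (f1 ^ 3 / f3)] is at most [K n (1 / sqrt f2)], whose
    expectation is that of [f1 / sqrt f2], hence at most 1
    ([integral_sq_ratio], [integral_cube_ratio]). So almost surely both ratios
    are polynomially bounded in [n] ([ae_pronic_bound]), and [U (2 * n)] and
    [U (3 * n)] are at least [U n ^ 2] and [U n ^ 3] up to polynomial factors.

    As [U] is monotone and the numbers [2 ^ i * 3 ^ j] are dense on a
    logarithmic scale, [ln (U n) / n] converges ([scaling_limit]). If its limit
    is positive, then almost all of [U n] sits at distances close to [n], where
    the weights are close to [q ^ (- n / 2)] on the exponential scale, and the
    ball sizes have a growth rate too ([ln_ball_cvg]). If the limit is 0, then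
    the upper growth rate is at most [sqrt q], which the hypothesis excludes
    unless [d = 1]; in that case all weights are 1. *)

(** * Graph distance *)

Section distance.
Variable G : graph.
Implicit Types (x y z c : vertex G) (p : seq (vertex G)) (k : nat).

Lemma ex_dist x y : exists k, `[< vball x k y >].
Proof.
have [p xp yp] := adj_conn x y.
by exists (size p); apply/asboolP; exists p; split.
Qed.

Definition dist x y := ex_minn (ex_dist x y).

Lemma dist_le x p : path (@adj G) x p -> (dist x (last x p) <= size p)%N.
Proof.
move=> xp; rewrite /dist; case: ex_minnP => m _; apply.
by apply/asboolP; exists p; split.
Qed.

Lemma geodesic x y : exists p, [/\ path (@adj G) x p, last x p = y,
  uniq (x :: p) & size p = dist x y].
Proof.
have [p [xp yp pd]] : vball x (dist x y) y.
  by rewrite /dist; case: ex_minnP => m /asboolP.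
case/shortenP: xp yp => p' xp' up' sp' yp; exists p'; split => //.
apply/eqP; rewrite eqn_leq -{2}yp dist_le // andbT.
by apply: leq_trans (uniq_leq_size _ sp') pd; case/andP: up'.
Qed.

Lemma vball_dist x k y : vball x k y <-> (dist x y <= k)%N.
Proof.
split=> [[p [xp <- pk]]|xyk]; first exact: leq_trans (dist_le xp) pk.
by have [p [xp yp _ pd]] := geodesic x y; exists p; rewrite pd; split.
Qed.

Lemma rev_walk x p : path (@adj G) x p -> exists p',
  [/\ path (@adj G) (last x p) p', last (last x p) p' = x, size p' = size p &
      {subset p' <= x :: p}].
Proof.
move=> xp; exists (rev (belast x p)); split.
- by rewrite rev_path; rewrite (eq_path (e' := @adj G)) // => a b; rewrite adj_sym.
- by case: p xp => //= a p _; rewrite rev_cons last_rcons.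
- by rewrite size_rev size_belast.
- by move=> a; rewrite mem_rev; exact: mem_belast.
Qed.

Lemma distC x y : dist x y = dist y x.
Proof.
wlog suff h : x y / (dist x y <= dist y x)%N.
  by apply/eqP; rewrite eqn_leq !h.
have [p [yp xp _ <-]] := geodesic y x.
have [p' [yp' xp' <- _]] := rev_walk yp.
by move: (dist_le yp'); rewrite xp' xp.
Qed.

Lemma dist_triangle y x z : (dist x z <= dist x y + dist y z)%N.
Proof.
have [p [xp yp _ <-]] := geodesic x y; have [p' [yp' zp' _ <-]] := geodesic y z.
have := @dist_le x (p ++ p'); rewrite last_cat yp zp' size_cat; apply.
by rewrite cat_path xp yp.
Qed.

Lemma distxx x : dist x x = 0%N.
Proof. by apply/eqP; rewrite -leqn0; exact: (@dist_le x [::]). Qed.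

Lemma dist_eq0 x y : dist x y = 0%N -> x = y.
Proof. by have [p [_ yp _ <-]] := geodesic x y => /size0nil p0; rewrite -yp p0. Qed.

Lemma dist_split x p1 p2 : path (@adj G) x (p1 ++ p2) ->
  size (p1 ++ p2) = dist x (last x (p1 ++ p2)) ->
  dist x (last x p1) = size p1 /\
  dist (last x p1) (last x (p1 ++ p2)) = size p2.
Proof.
rewrite cat_path last_cat size_cat => /andP[xp1 xp2] pd.
have := dist_triangle (last x p1) x (last (last x p1) p2).
have := dist_le xp1; have := dist_le xp2; lia.
Qed.

Lemma dist_parent x y k : dist x y = k.+1 -> exists2 z, adj z y & dist x z = k.
Proof.
have [p [xp yp _ pk]] := geodesic x y; rewrite -{1}pk.
elim/last_ind: p xp yp pk => // p a _ xp yp pk; rewrite size_rcons => -[<-].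
move: xp yp pk; rewrite -cats1 => xp yp; rewrite -{1}yp => pk.
exists (last x p); last by have [] := dist_split xp pk.
by move: xp yp; rewrite cat_path last_cat /= => /and3P[_ + _] <-.
Qed.

Definition fball x k : {fset vertex G} := fset_set (vball x k).

Lemma in_fball x k y : (y \in fball x k) = (dist x y <= k)%N.
Proof.
rewrite in_fset_set; last exact: finite_vball.
by apply/idP/idP => [/set_mem/vball_dist|/vball_dist/mem_set].
Qed.

Definition nbrs x : {fset vertex G} := fset_set [set y | adj x y].

Lemma finite_nbrs x : finite_set [set y | adj x y].
Proof.
have [D hD] := adj_bdd G; exact: card_le_finite (hD x) (finite_II D).
Qed.

Lemma in_nbrs x y : (y \in nbrs x) = adj x y.
Proof.
rewrite in_fset_set; last exact: finite_nbrs.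
by apply/idP/idP => [/set_mem|?]; last exact/mem_set.
Qed.

Lemma card_nbrs d x : degree_le G d -> (#|` nbrs x| <= d)%N.
Proof.
by move=> /(_ x); exact: geq_card_fset_set.
Qed.

End distance.

(** * Geodesics in trees *)

Lemma first_hit (T : eqType) (A : pred T) (x : T) (p : seq T) :
  A (last x p) -> exists p1 p2,
    [/\ p = p1 ++ p2, A (last x p1) & ~~ has A (belast x p1)].
Proof.
elim: p x => [|a p IH] x Ap; first by exists [::], [::].
have [Ax|nAx] := boolP (A x); first by exists [::], (a :: p).
have [p1 [p2 [-> ? ?]]] := IH _ Ap.
by exists (a :: p1), p2; split => //=; rewrite negb_or nAx.
Qed.

(** Walk back along [p] from [b] to its start and then forth to [a], and cut
    out the loops. *)
Lemma walk_between (G : graph) (x a b : vertex G) (p : seq (vertex G)) :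
  path (@adj G) x p -> a \in x :: p -> b \in x :: p -> exists e,
    [/\ path (@adj G) b e, last b e = a, uniq (b :: e) &
        {subset e <= x :: p}].
Proof.
move=> + + bp; case/splitPl: bp => b1 b2 lb pb ap.
move: pb ap; set p' := b1 ++ b2 => pb ap.
have : {subset x :: b1 <= x :: p'}.
  by move=> v; rewrite !inE mem_cat => /orP[->//|->]; rewrite orbT.
move: pb (pb); rewrite {1}cat_path => /andP[/rev_walk[r [br rx _ rs]] _] pb sb.
have [a1 [a2 [pa la]]] : exists a1 a2, p' = a1 ++ a2 /\ last x a1 = a.
  by case/splitPl: ap => a1 a2 <-; exists a1, a2.
have : path (@adj G) b (r ++ a1).
  by rewrite cat_path -lb br rx; move: pb; rewrite pa cat_path => /andP[].
have : last b (r ++ a1) = a by rewrite last_cat -lb rx.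
move=> + h; case/shortenP: h => e be ue es ea; exists e; split => // v /es.
by rewrite mem_cat => /orP[/rs/sb//|v1]; rewrite pa inE mem_cat v1 orbT.
Qed.

(** A vertex [c] of a simple path that a second path with the same ends avoids
    lies on a simple cycle: from [c] follow the first path in both directions
    up to the second one, and close up along the second one. *)
Lemma tree_simple_sub (G : graph) (x : vertex G) (p p' : seq (vertex G)) :
  is_tree G -> path (@adj G) x p -> uniq (x :: p) -> path (@adj G) x p' ->
  last x p' = last x p -> {subset x :: p <= x :: p'}.
Proof.
move=> treeG + + xp' pp' c cp; case/splitPl: cp pp' => p1 p2 cE lp xp up.
apply/negPn/negP => cA; set A := mem (x :: p').
have [b1 [b2 [p2E Ab nb]]] : exists b1 b2,
    [/\ p2 = b1 ++ b2, A (last c b1) & ~~ has A (belast c b1)].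
  apply: first_hit; change (last c p2 \in x :: p').
  by move: lp; rewrite last_cat cE => <-; exact: mem_last.
move: xp; rewrite cat_path cE => /andP[xp1 cp2].
have cr : path (@adj G) c (rev (belast x p1)).
  by rewrite -cE rev_path (eq_path (e' := @adj G)) // => u v; rewrite adj_sym.
have rE : c :: rev (belast x p1) = rev (x :: p1).
  by rewrite [in RHS]lastI rev_rcons cE.
have [a1 [a2 [rE2 Aa na]]] : exists a1 a2,
    [/\ rev (belast x p1) = a1 ++ a2, A (last c a1) & ~~ has A (belast c a1)].
  apply: first_hit; rewrite -(last_cons c) rE rev_cons last_rcons.
  exact: mem_head.
have nAc : ~~ A c by [].
case/lastP: b1 p2E Ab nb => [|b1 b] p2E; first by rewrite (negbTE nAc).
case/lastP: a1 rE2 Aa na => [|a1 a] rE2; first by rewrite (negbTE nAc).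
rewrite !last_rcons !belast_rcons /= !negb_or => Aa /andP[_ na] Ab /andP[_ nb].
have : uniq (c :: rev (belast x p1) ++ p2).
  by rewrite -cat_cons rE (@perm_uniq _ _ ((x :: p1) ++ p2)) // perm_cat2r perm_rev.
rewrite rE2 p2E => uc.
(* [b] and [a] are where the first path meets the second one after and
   before [c]. *)
have [e [be ea ue es]] := walk_between xp' Aa Ab.
have /treeG : cycle (@adj G) (c :: b1 ++ (b :: e) ++ rev a1).
  rewrite /= rcons_cat /= rcons_cat cat_path /=.
  have /andP[/andP[-> ->] _] : (path (@adj G) c b1 && adj (last c b1) b) &&
      path (@adj G) b b2.
    by move: cp2; rewrite p2E cat_path rcons_path last_rcons.
  rewrite cat_path be ea /=.
  move: cr; rewrite rE2 cat_path => /andP[cr _].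
  have -> : rcons (rev a1) c = rev (belast c (rcons a1 a)).
    by rewrite belast_rcons rev_cons.
  rewrite -[a in path _ a _](last_rcons c a1 a) rev_path.
  by rewrite (eq_path (e' := @adj G)) // => u v; rewrite adj_sym.
have uc' : uniq (c :: a1 ++ b1).
  apply: subseq_uniq uc; rewrite /= eqxx; apply: cat_subseq.
    by rewrite -cats1 -catA prefix_subseq.
  by rewrite -cats1 -catA prefix_subseq.
have -> : uniq (c :: b1 ++ (b :: e) ++ rev a1).
  rewrite (@perm_uniq _ _ ((b :: e) ++ (c :: a1 ++ b1))); last first.
    by apply/permP => P; rewrite /= !count_cat /= !count_cat count_rev; clear; lia.
  have sA : {subset b :: e <= A}.
    by move=> v; rewrite inE => /predU1P[->|/es].
  rewrite cat_uniq ue uc' andbT; apply/hasPn => v.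
  have nA s : ~~ has A s -> v \in s -> v \notin b :: e.
    by move=> /hasPn ns /ns; apply: contra => /sA.
  rewrite inE mem_cat => /predU1P[->|/orP[|]]; last 2 first.
  - exact: nA.
  - exact: nA.
  by apply: contra nAc => /sA.
rewrite /= size_cat /= size_cat.
have : e != [::].
  apply/eqP => e0; move: uc; rewrite -ea e0 /= mem_cat => /andP[_].
  rewrite cat_uniq => /and3P[_ /hasPn/(_ b)]; rewrite !mem_cat !mem_rcons !inE eqxx.
  by move=> /(_ isT).
by case: e {be ue es ea} => //= v e _ /(_ isT); rewrite !addnS.
Qed.

(** The first vertex [c] of the geodesic from [x] to [y] that lies on the
    geodesic from [y] to [z] works: the outer pieces of these geodesics form a
    simple path through [c] with the ends of [p], so [tree_simple_sub] puts
    [c] on [p]. *)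
Lemma tree_median (G : graph) (x y : vertex G) (p : seq (vertex G)) :
  is_tree G -> path (@adj G) x p -> exists2 c, c \in x :: p &
  (dist x y + dist y (last x p) = dist x c + dist c (last x p) + 2 * dist c y)%N.
Proof.
move=> treeG xp; set z := last x p.
have [g [xg gy ug dg]] := geodesic x y; have [h [yh hz uh dh]] := geodesic y z.
have [g1 [g2 [gE Ac nA]]] : exists g1 g2, [/\ g = g1 ++ g2,
    last x g1 \in y :: h & ~~ has (mem (y :: h)) (belast x g1)].
  by apply: (@first_hit _ (mem (y :: h))); rewrite gy; exact: mem_head.
set c := last x g1 in Ac *.
have [h1 [h2 [hE hc]]] : exists h1 h2, h = h1 ++ h2 /\ last y h1 = c.
  by case/splitPl: Ac => h1 h2 <-; exists h1, h2.
have [xc cy] : dist x c = size g1 /\ dist c y = size g2.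
  have := @dist_split _ x g1 g2; rewrite -gE dg gy => /(_ xg)[] //.
have [yc cz] : dist y c = size h1 /\ dist c z = size h2.
  by have := @dist_split _ y h1 h2; rewrite -hE dh hz hc => /(_ yh)[].
exists c; last first.
  move: dg dh yc; rewrite gE hE !size_cat (distC y c) cy xc cz => <- <- ->.
  by clear; lia.
apply: (@tree_simple_sub G x (g1 ++ h2)) => //.
- move: xg yh; rewrite gE hE !cat_path hc => /andP[-> _] /andP[_ ->] //.
- move: ug uh; rewrite gE hE -!cat_cons !cat_uniq => /andP[-> _] /and3P[_ nh ->].
  rewrite andbT; apply/hasPn => v vh; rewrite lastI mem_rcons inE negb_or.
  apply/andP; split.
    by apply: contraNneq (hasPn nh _ vh) => ->; rewrite -/c -hc mem_last.
  apply: contraNN nA => vg; apply/hasP; exists v => //=.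
  by rewrite hE -cat_cons mem_cat vh orbT.
- by rewrite last_cat -/c -hc -last_cat -hE hz.
- by rewrite -cat_cons mem_cat /c mem_last.
Qed.

(** * The weighted ball operator on a tree *)

Section spheres.
Variable G : graph.
Implicit Types (x y z c : vertex G) (q j n m : nat).

Definition sphere c j : {fset vertex G} :=
  [fset y in fball c j | dist c y == j]%fset.

Lemma in_sphere c j y : (y \in sphere c j) = (dist c y == j).
Proof.
by rewrite !inE /= in_fball; case: eqP => [->|]; rewrite ?leqnn ?andbF.
Qed.

(** One of the at most [q + 1] neighbours of a vertex at distance [j + 1] is
    nearer to [c], which leaves [q] at distance [j + 2]. *)
Lemma card_sphereS c q j : degree_le G q.+1 ->
  (#|` sphere c j.+2| <= q * #|` sphere c j.+1|)%N.
Proof.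
move=> deg; rewrite -sum1_size.
apply: (@leq_trans (\sum_(z <- sphere c j.+2) \sum_(y <- sphere c j.+1) adj y z)).
  rewrite big_seq [leqRHS]big_seq; apply: leq_sum => z.
  rewrite in_sphere => /eqP/dist_parent[y yz yd].
  have yS : y \in sphere c j.+1 by rewrite in_sphere yd.
  by rewrite (big_fsetD1 y) //= yz.
have <- : (\sum_(y <- sphere c j.+1) q = q * #|` sphere c j.+1|)%N.
  by rewrite big_const_seq iter_addn_0 count_predT.
rewrite exchange_big /= big_seq [leqRHS]big_seq.
apply: leq_sum => y; rewrite in_sphere => /eqP/dist_parent[x xy xd].
have -> : (\sum_(z <- sphere c j.+2) adj y z =
    size [seq z <- sphere c j.+2 | adj y z])%N.
  by rewrite size_filter -sum1_count [RHS]big_mkcond; apply: eq_bigr => z _; case: adj.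
have : (#|` (nbrs y `\ x)%fset| <= q)%N.
  by move: (card_nbrs y deg); rewrite (cardfsD1 x) in_nbrs adj_sym xy.
move=> h; apply: leq_trans h; apply: uniq_leq_size.
  exact: (filter_uniq _ (fset_uniq _)).
move=> z; rewrite mem_filter in_sphere in_fsetD1 in_nbrs => /andP[-> /eqP zd].
by rewrite andbT; apply: contraPneq zd => ->; rewrite xd; lia.
Qed.

Lemma card_sphere c q j : (0 < q)%N -> degree_le G q.+1 ->
  (#|` sphere c j| <= 2 * q ^ j)%N.
Proof.
move=> q0 deg; case: j => [|j].
  apply: (@leq_trans 1) => //.
  apply: (@uniq_leq_size _ _ [:: c]) => [|y]; first exact: fset_uniq.
  by rewrite in_sphere => /eqP/dist_eq0 ->; rewrite inE.
elim: j => [|j IH].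
  apply: (@leq_trans q.+1); last by rewrite expn1; lia.
  apply: leq_trans (card_nbrs c deg).
  apply: uniq_leq_size => [|y]; first exact: fset_uniq.
  rewrite in_sphere in_nbrs => /eqP.
  by case/dist_parent => z zy /dist_eq0 ->.
apply: leq_trans (card_sphereS _ _ deg) _.
by rewrite expnS mulnCA leq_mul2l IH orbT.
Qed.

End spheres.

Lemma ler_sum_mem (R : realType) (I : eqType) (s : seq I) (F : I -> R) i :
  (forall j, 0 <= F j) -> i \in s -> F i <= \sum_(j <- s) F j.
Proof.
move=> F0; elim: s => // a s IH; rewrite inE big_cons => /predU1P[<-|/IH Fs].
  by rewrite lerDl sumr_ge0.
by rewrite ler_wpDl.
Qed.

Section ball_sum.
Variables (R : realType) (r : R).

(** The operator with kernel [r ^ dist x y], cut off at distance [n]. It is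
    used for [r = 1 / sqrt q]; up to a polynomial factor the kernel then is the
    spherical function of the [q + 1]-regular tree at the edge of the spectrum. *)
Definition ball_sum (n : nat) (G : graph) (u : vertex G -> R) (x : vertex G) : R :=
  \sum_(y <- fball x n) r ^+ dist x y * u y.

(** Charge [y] to its median [c] with [x] and [z], on a fixed geodesic, and to
    [j = dist c y]. The exponent then is [dist x z + 2 * j], and the weight
    [r ^ (2 * j)] makes up for the at most [2 * q ^ j] vertices [y] charged to
    the pair [(c, j)]. *)
Lemma ball_sum_kernel (G : graph) (q n m : nat) (x z : vertex G) :
  is_tree G -> (0 < q)%N -> degree_le G q.+1 ->
  0 < r -> r <= 1 -> r ^+ 2 * q%:R <= 1 -> (dist x z <= n + m)%N ->
  \sum_(y <- fball x n) r ^+ dist x y * r ^+ dist y z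
    <= (2 * (n + m).+1 * n.+1)%:R * r ^+ dist x z.
Proof.
move=> treeG q0 deg r0 r1 rq xz.
have r_ge0 := ltW r0.
have [p [xp pz up sp]] := geodesic x z.
pose F c j := r ^+ (dist x z + 2 * j).
apply: (@le_trans _ _ (\sum_(y <- fball x n) \sum_(c <- x :: p) \sum_(j < n.+1)
    (dist c y == j)%:R * r ^+ (dist x z + 2 * j))).
  rewrite big_seq [leRHS]big_seq; apply: ler_sum => y; rewrite in_fball => yn.
  have [c cp] := tree_median y treeG xp; rewrite pz => cE.
  have h1 := dist_triangle c y z; have h2 := dist_triangle c x z.
  rewrite (distC y c) in h1.
  have cn : (dist c y < n.+1)%N by lia.
  apply: le_trans (@ler_sum_mem _ _ _ _ c _ cp); last first.
    by move=> b; apply: sumr_ge0 => j _; rewrite mulr_ge0 ?ler0n ?exprn_ge0.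
  rewrite (bigD1 (Ordinal cn)) //= eqxx mul1r ler_wpDr //.
    by apply: sumr_ge0 => j _; rewrite mulr_ge0 ?ler0n ?exprn_ge0.
  by rewrite -exprD ler_wiXn2l //; lia.
rewrite exchange_big /=.
apply: (@le_trans _ _ (\sum_(c <- x :: p) \sum_(j < n.+1) 2 * r ^+ dist x z)).
  apply: ler_sum => c _; rewrite exchange_big; apply: ler_sum => j _ /=.
  rewrite -mulr_suml.
  have -> : \sum_(y <- fball x n) (dist c y == j)%:R =
      (count (fun y => dist c y == j) (fball x n))%:R :> R.
    rewrite -sum1_count natr_sum [RHS]big_mkcond /=.
    by apply: eq_bigr => y _; case: eqP.
  have cS : (count (fun y => dist c y == j) (fball x n) <= 2 * q ^ j)%N.
    apply: leq_trans (card_sphere c j q0 deg); rewrite -size_filter.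
    apply: uniq_leq_size; first exact: (filter_uniq _ (fset_uniq _)).
    by move=> y; rewrite mem_filter in_sphere => /andP[].
  apply: (@le_trans _ _ ((2 * q ^ j)%:R * r ^+ (dist x z + 2 * j))).
    by rewrite ler_wpM2r ?exprn_ge0 // ler_nat.
  rewrite natrM natrX exprD exprM mulrCA -!mulrA.
  rewrite [leLHS](_ : _ = 2 * r ^+ dist x z * (r ^+ 2 * q%:R) ^+ j); last first.
    rewrite [X in _ = _ * X]exprMn.
    by move: (r ^+ dist x z) ((r ^+ 2) ^+ j) (q%:R ^+ j) => a b e; clear; lra.
  rewrite ler_piMr ?mulr_ge0 ?exprn_ge0 //.
  by rewrite exprn_ile1 // mulr_ge0 ?exprn_ge0.
rewrite big_const_seq count_predT iter_addr_0 /= sumr_const card_ord sp.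
rewrite -mulrnA -[leLHS]mulr_natl mulrA ler_wpM2r ?exprn_ge0 //.
by rewrite -natrM ler_nat; move: (dist x z) xz; clear; nia.
Qed.

Lemma ler_ball_sum G n (u v : vertex G -> R) x : 0 <= r ->
  (forall y, u y <= v y) -> ball_sum n u x <= ball_sum n v x.
Proof.
by move=> r0 uv; apply: ler_sum => y _; rewrite ler_wpM2l ?exprn_ge0.
Qed.

Lemma ball_sumZ G n a (u : vertex G -> R) x :
  ball_sum n (fun y => a * u y) x = a * ball_sum n u x.
Proof. by rewrite /ball_sum mulr_sumr; apply: eq_bigr => y _; rewrite mulrCA. Qed.

Lemma ball_sum_center G n (u : vertex G -> R) x : 0 <= r ->
  (forall y, 0 <= u y) -> u x <= ball_sum n u x.
Proof.
move=> r0 u0; rewrite /ball_sum (big_fsetD1 x) /=; last by rewrite in_fball distxx.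
rewrite distxx expr0 mul1r lerDl sumr_ge0 // => y _.
by rewrite mulr_ge0 ?exprn_ge0.
Qed.

(** After exchanging the sums, [ball_sum_kernel] applies at each end point. So
    the cut-off kernels are stable under composition, up to a polynomial
    factor and the addition of the cut-offs; it is here that the graph has to
    be a tree. *)
Lemma ball_sum_comp (G : graph) (q n m : nat) (x : vertex G) :
  is_tree G -> (0 < q)%N -> degree_le G q.+1 ->
  0 < r -> r <= 1 -> r ^+ 2 * q%:R <= 1 ->
  ball_sum n (ball_sum m (fun=> 1)) x
    <= (2 * (n + m).+1 * n.+1)%:R * ball_sum (n + m) (fun=> 1) x.
Proof.
move=> treeG q0 deg r0 r1 rq; have r_ge0 := ltW r0.
apply: (@le_trans _ _ (\sum_(y <- fball x n) \sum_(z <- fball x (n + m))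
    r ^+ dist x y * r ^+ dist y z)).
  rewrite /ball_sum big_seq [leRHS]big_seq; apply: ler_sum => y.
  rewrite in_fball => yn; rewrite -mulr_sumr ler_wpM2l ?exprn_ge0 //.
  under eq_bigr do rewrite mulr1.
  have sub : (fball y m `<=` fball x (n + m))%fset.
    apply/fsubsetP => z; rewrite !in_fball => zm.
    exact: leq_trans (dist_triangle y x z) (leq_add yn zm).
  rewrite [leRHS](big_fsetID _ (mem (fball y m))) /= ler_wpDr //.
    by apply: sumr_ge0 => z _; rewrite exprn_ge0.
  rewrite [leRHS](_ : _ = \sum_(z <- fball y m) r ^+ dist y z) //.
  apply: eq_fbigl => z; rewrite !inE /=; apply/andP/idP => [[]//|zm].
  by split => //; exact: (fsubsetP sub).
rewrite exchange_big /= /ball_sum mulr_sumr big_seq [leRHS]big_seq.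
apply: ler_sum => z; rewrite in_fball mulr1 => xz.
exact: ball_sum_kernel treeG q0 deg r0 r1 rq xz.
Qed.

End ball_sum.

(** * Density of the products of powers of 2 and 3 *)

Section dense23.
Variable R : realType.

Lemma ln2_ln3_indep (s t : nat) : (0 < s)%N -> ln 2 *+ s != ln 3 *+ t :> R.
Proof.
move=> s0; rewrite -!lnXn //; apply/eqP => /ln_inj; rewrite !posrE.
rewrite !exprn_gt0 // => /(_ isT isT) /eqP; rewrite -!natrX eqr_nat => /eqP.
by move=> /(congr1 odd); rewrite !oddX /= orbT; case: s s0.
Qed.

(** Dirichlet's argument: two of the fractional parts of the multiples of
    [ln 2 / ln 3] fall into the same of [K + 1] boxes. *)
Lemma ln23_small (e : R) : 0 < e ->
  exists s t : nat, 0 < `|ln 2 *+ s - ln 3 *+ t : R| < e.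
Proof.
move=> e0; set u : R := ln 2; set v : R := ln 3.
have u0 : 0 < u by rewrite ln_gt0 // ltr1n.
have v0 : 0 < v by rewrite ln_gt0 // ltr1n.
have [K Ke] : exists K : nat, v / e < K.+1%:R.
  by exists (Num.trunc (v / e)); exact: truncnS_gt.
pose q (i : nat) := Num.trunc (u *+ i / v).
pose f (i : nat) := u *+ i / v - (q i)%:R.
have uiv i : 0 <= u *+ i / v by rewrite divr_ge0 ?mulrn_wge0 // ltW.
have f01 i : 0 <= f i < 1.
  have /andP[h1 h2] := truncn_itv (uiv i).
  by rewrite /f subr_ge0 /q h1 ltrBlDl natr1.
pose g (i : 'I_K.+2) : 'I_K.+1 := inord (Num.trunc (K.+1%:R * f i)).
have /injectivePn[i [j ij gij]] : ~~ injectiveb g.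
  by apply/injectiveP => /leq_card; rewrite !card_ord ltnn.
wlog ji : i j ij gij / (j < i)%N.
  move=> h; case: (ltngtP i j) => [/(h j i)|/(h i j)|/val_inj eij].
  - by apply => //; rewrite eq_sym.
  - by apply.
  - by rewrite eij eqxx in ij.
have Kf n : 0 <= K.+1%:R * f n by have /andP[? _] := f01 n; rewrite mulr_ge0.
have gE (n : 'I_K.+2) : g n = Num.trunc (K.+1%:R * f n) :> nat.
  rewrite /g inordK // truncn_lt_nat // -[ltRHS]mulr1 ltr_pM2l ?ltr0n //.
  by have /andP[] := f01 n.
have qji : (q j <= q i)%N.
  apply: le_truncn; rewrite ler_pM2r ?invr_gt0 //.
  by apply: ler_wpMn2l; [exact: ltW|exact: ltnW].
exists (i - j)%N, (q i - q j)%N.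
rewrite normr_gt0 subr_eq0 ln2_ln3_indep ?subn_gt0 //=.
have -> : u *+ (i - j) - v *+ (q i - q j) = v * (f i - f j).
  have vf n : v * f n = u *+ n - v *+ q n.
    by rewrite /f mulrBr mulrC divfK ?gt_eqF // mulr_natr.
  rewrite mulrBr !vf !mulrnBr // 1?ltnW //.
  by move: (u *+ i) (u *+ j) (v *+ q i) (v *+ q j) => a b a' b'; clear; lra.
rewrite normrM (gtr0_norm v0) -ltr_pdivlMl //.
have K0 : 0 < K.+1%:R :> R by rewrite ltr0n.
have : `|K.+1%:R * (f i - f j)| < 1.
  have := truncn_itv (Kf i); have := truncn_itv (Kf j).
  rewrite -!gE gij (mulrBr _ (f i)); move: (K.+1%:R * _) (K.+1%:R * _) => a b.
  rewrite -natr1 => /andP[? ?] /andP[? ?].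
  by rewrite ltr_norml; apply/andP; split; lra.
rewrite normrM gtr0_norm // -ltr_pdivlMl // mulr1 => /lt_trans; apply.
by rewrite invf_plt ?posrE ?mulr_gt0 ?invr_gt0 // invfM invrK.
Qed.

(** Adding multiples of the small number [u *+ s - v *+ t] to multiples of [v]
    hits every window of length [e]; far enough out, the negative coefficient
    of [v] in the former is absorbed by the latter. *)
Lemma window (u v e : R) (s t : nat) : 0 < u -> 0 < v ->
  0 < u *+ s - v *+ t < e -> exists Y, forall y, Y <= y ->
  exists i j : nat, u *+ i + v *+ j <= y <= u *+ i + v *+ j + e.
Proof.
move=> u0 v0; set w := _ - _ => /andP[w0 we].
have vw0 : 0 <= v / w by rewrite divr_ge0 // ltW.
set B := Num.trunc (v / w).
exists (v *+ (B * t)) => y Yy.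
have y0 : 0 <= y by apply: le_trans Yy; rewrite mulrn_wge0 // ltW.
set m := Num.trunc (y / v).
have /andP[m1 m2] := truncn_itv (divr_ge0 y0 (ltW v0)).
rewrite -/m in m1 m2.
rewrite ler_pdivlMr // in m1; rewrite ltr_pdivrMr // in m2.
pose rem := y - v *+ m.
have rem0 : 0 <= rem by rewrite /rem subr_ge0 -mulr_natl.
have remv : rem < v by rewrite /rem ltrBlDl -mulrSr -mulr_natl.
set k := Num.trunc (rem / w).
have /andP[k1 k2] := truncn_itv (divr_ge0 rem0 (ltW w0)).
rewrite -/k in k1 k2.
rewrite ler_pdivlMr // in k1; rewrite ltr_pdivrMr // in k2.
have kB : (k <= B)%N by apply: le_truncn; rewrite ler_pM2r ?invr_gt0 // ltW.
have ktm : (k * t <= m)%N.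
  apply: (@leq_trans (B * t)); first by rewrite leq_mul2r kB orbT.
  rewrite truncn_ge_nat; last by rewrite divr_ge0 // ltW.
  by rewrite ler_pdivlMr // mulr_natl.
exists (k * s)%N, (m - k * t)%N.
have -> : u *+ (k * s) + v *+ (m - k * t) = k%:R * w + v *+ m.
  by rewrite mulrnBr // /w ![(k * _)%N]mulnC !mulrnA mulrBr !mulr_natl; lra.
rewrite -mulr_natl -natr1 mulrDl mul1r in k2.
by apply/andP; split; move: k1 k2; rewrite /rem; lra.
Qed.

(** The numbers [2 ^ i * 3 ^ j] are dense on a logarithmic scale. *)
Lemma window23 (e : R) : 0 < e -> exists Y, forall y, Y <= y ->
  exists i j : nat, ln 2 *+ i + ln 3 *+ j <= y <= ln 2 *+ i + ln 3 *+ j + e.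
Proof.
move=> /ln23_small[s [t]].
have l2 : 0 < ln 2 :> R by rewrite ln_gt0 // ltr1n.
have l3 : 0 < ln 3 :> R by rewrite ln_gt0 // ltr1n.
case: (ltrP 0 (ln 2 *+ s - ln 3 *+ t : R)) => [h|h].
  by rewrite gtr0_norm // => hs; exact: (window l2 l3 hs).
rewrite ler0_norm // opprB => hs; have [Y hY] := window l3 l2 hs.
exists Y => y /hY[i [j hij]]; exists j, i.
by rewrite [ln 2 *+ j + _]addrC.
Qed.

End dense23.

(** * Limits from doubling and tripling *)

Section scaling_limit.
Variables (R : realType) (a : nat -> R) (B D : R).
Hypothesis a_ge0 : forall n, 0 <= a n.
Hypothesis a_homo : {homo a : n m / (n <= m)%N >-> n <= m}.
Hypothesis a_le : forall n, a n <= B * n%:R.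
Hypothesis D0 : 0 <= D.
Hypothesis a_scale : forall k n, k \in [:: 2; 3]%N -> (0 < n)%N ->
  k%:R * a n - D * Num.sqrt n%:R <= a (k * n).

(** Subtracting a multiple of [1 / sqrt n] absorbs the errors of all later
    doublings and triplings, as those errors decay geometrically. *)
Let c n := a n / n%:R - 2 * D / Num.sqrt n%:R.

Let c_scale k n : k \in [:: 2; 3]%N -> (0 < n)%N -> c n <= c (k * n).
Proof.
move=> k23 n0; have := a_scale k23 n0; rewrite /c.
have k2 : (2 <= k)%N by move: k23; rewrite !inE => /orP[] /eqP ->.
have kR : 2 <= k%:R :> R by rewrite ler_nat.
set A := a n; set A' := a (k * n); rewrite natrM sqrtrM ?ler0n //.
set t := Num.sqrt k%:R; set s := Num.sqrt n%:R.
have s0 : 0 < s by rewrite sqrtr_gt0 ltr0n.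
have -> : n%:R = s ^+ 2 by rewrite sqr_sqrtr.
have t0 : 0 < t by rewrite sqrtr_gt0; lra.
have t2 : t ^+ 2 = k%:R by rewrite sqr_sqrtr //; lra.
have t43 : 4 / 3 <= t by nra.
move=> h; rewrite -t2.
have h1 : A / s ^+ 2 - D / (t ^+ 2 * s) <= A' / (t ^+ 2 * s ^+ 2).
  have X0 : 0 < (t ^+ 2 * s ^+ 2)^-1 by rewrite invr_gt0 mulr_gt0 ?exprn_gt0.
  move: h; rewrite -(ler_pM2r X0) -t2 => /(le_trans _); apply.
  rewrite [s ^+ 2]expr2 !invfM [leRHS](_ : _ = A * (s^-1 * s^-1) * (t ^+ 2 * (t ^+ 2)^-1) -
    D * ((t ^+ 2)^-1 * s^-1) * (s * s^-1)); last by lra.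
  rewrite !divff ?mulr1 ?expf_neq0 ?gt_eqF //.
  by rewrite -[t^-1 / t]invfM -expr2.
have h2 : D / (t ^+ 2 * s) + 2 * D / (t * s) <= 2 * D / s.
  rewrite !invfM; set p := t^-1; set x := s^-1.
  have x0 : 0 < x by rewrite invr_gt0.
  have p0 : 0 < p by rewrite invr_gt0.
  have pt : p <= 3 / 4 by rewrite /p -[3/4]invrK lef_pV2 ?posrE // invf_div.
  have p2 : (t ^+ 2)^-1 <= 1 / 2 by rewrite t2 div1r lef_pV2 ?posrE //; lra.
  rewrite expr2 invfM -/p in p2.
  have : D * x * (p * p + 2 * p) <= D * x * 2.
    by rewrite ler_wpM2l ?mulr_ge0 // ?(ltW x0) //; lra.
  by lra.
by move: h1 h2; lra.
Qed.

Let c_scaleX i j n : (0 < n)%N -> c n <= c (2 ^ i * 3 ^ j * n).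
Proof.
move=> n0; elim: i => [|i IH].
  elim: j => [|j IH]; first by rewrite !mul1n.
  apply: le_trans IH _; rewrite !mul1n expnS -mulnA; apply: c_scale => //.
  by rewrite muln_gt0 expn_gt0.
apply: le_trans IH _; rewrite expnS -!mulnA; apply: c_scale => //.
by rewrite !muln_gt0 !expn_gt0.
Qed.

Let c_le n : (0 < n)%N -> c n <= B.
Proof.
move=> n0; rewrite /c lerBlDr ler_wpDr ?divr_ge0 ?mulr_ge0 ?sqrtr_ge0 //.
by rewrite ler_pdivrMr ?ltr0n.
Qed.

(** The limit is the supremum of [c]: if [c n] is close to it, then so are the
    values of [c] at all [2 ^ i * 3 ^ j * n]. By [window23] every large [N]
    exceeds such a number by a factor close to 1 only, and [a] is monotone. *)
Lemma scaling_limit : exists2 l : R, 0 <= l & a n / n%:R @[n --> \oo] --> l.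
Proof.
pose S := [set c n | n in [set n | (0 < n)%N]].
have supS : has_sup S.
  by split; [exists (c 1%N), 1%N|exists B => _ [n n0 <-]; exact: c_le].
pose l : R := sup S.
have B0 : 0 <= B by have := le_trans (a_ge0 1) (a_le 1); rewrite mulr1.
have cvl : a n / n%:R @[n --> \oo] --> l.
  apply/cvgrPdist_le => e e0.
  have [_ [n n0 <-] cn] := sup_adherent (divr_gt0 e0 (ltr0n _ 2)) supS.
  have nR : 0 < n%:R :> R by rewrite ltr0n.
  have d0 : 0 < e / (2 * (B + 1)) by rewrite divr_gt0 //; lra.
  have [Y hY] := window23 d0.
  have [N1 hN1] : exists N1 : nat, n%:R * expR Y < N1.+1%:R.
    by exists (Num.trunc (n%:R * expR Y)); exact: truncnS_gt.
  have [N2 hN2] : exists N2 : nat, (2 * D / e) ^+ 2 < N2.+1%:R.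
    by exists (Num.trunc ((2 * D / e) ^+ 2)); exact: truncnS_gt.
  exists (maxn N1.+1 N2.+1) => // N /=; rewrite geq_max => /andP[NN1 NN2].
  have N0 : (0 < N)%N by exact: leq_trans NN1.
  have NR : 0 < N%:R :> R by rewrite ltr0n.
  have up : a N / N%:R <= l + e.
    have : c N <= l by apply: ub_le_sup => //; [case: supS|exists N].
    suff : 2 * D / Num.sqrt N%:R <= e by rewrite /c; lra.
    rewrite ler_pdivrMr ?sqrtr_gt0 // [e * _]mulrC -ler_pdivrMr //.
    rewrite -[leLHS]ger0_norm ?divr_ge0 ?mulr_ge0 ?(ltW e0) // -sqrtr_sqr.
    by apply: ler_wsqrtr; rewrite ltW // (lt_le_trans hN2) // ler_nat.
  have low : l - e <= a N / N%:R.
    have [|i [j /andP[ij1 ij2]]] := hY (ln (N%:R / n%:R)).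
      rewrite -ler_expR lnK ?posrE ?divr_gt0 // ler_pdivlMr // mulrC.
      by rewrite ltW // (lt_le_trans hN1) // ler_nat.
    pose M := (2 ^ i * 3 ^ j * n)%N.
    have MR : 0 < M%:R :> R by rewrite ltr0n !muln_gt0 !expn_gt0.
    have lnM : ln M%:R = ln 2 *+ i + ln 3 *+ j + ln n%:R :> R.
      by rewrite /M !natrM !natrX !lnM ?posrE ?mulr_gt0 ?exprn_gt0 // !lnXn.
    rewrite ln_div ?posrE // in ij1 ij2.
    have MN : (M <= N)%N by rewrite -(ler_nat R) -ler_ln ?posrE // lnM; lra.
    have NM : ln N%:R - ln M%:R <= e / (2 * (B + 1)) by rewrite lnM; lra.
    have aMN : a M / M%:R * (M%:R / N%:R) <= a N / N%:R.
      rewrite mulrA divfK ?gt_eqF // ler_pM2r ?invr_gt0 //; exact: a_homo.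
    have MNlow : 1 - e / (2 * (B + 1)) <= M%:R / N%:R.
      rewrite -[leRHS]lnK ?posrE ?divr_gt0 // ln_div ?posrE //.
      by apply: le_trans (expR_ge1Dx _); lra.
    have cM : c n <= a M / M%:R.
      apply: le_trans (c_scaleX i j n0) _; rewrite -/M /c lerBlDr lerDl.
      by rewrite divr_ge0 ?mulr_ge0 ?sqrtr_ge0.
    have aM0 : 0 <= a M / M%:R by rewrite divr_ge0.
    have aMB : a M / M%:R <= B by rewrite ler_pdivrMr.
    apply: le_trans aMN.
    have : a M / M%:R * (1 - e / (2 * (B + 1))) <= a M / M%:R * (M%:R / N%:R).
      by rewrite ler_wpM2l.
    have : a M / M%:R * (e / (2 * (B + 1))) <= e / 2.
      rewrite mulrA ler_pdivrMr; last lra.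
      rewrite [leRHS](_ : _ = (B + 1) * e); last lra.
      by rewrite ler_wpM2r ?(ltW e0) //; lra.
    by move: cn; rewrite -/l; lra.
  by rewrite ler_norml; apply/andP; split; lra.
exists l => //; apply: (cvgr_to_ge cvl); apply: nearW => n.
by rewrite divr_ge0.
Qed.

End scaling_limit.

(** * From weighted balls to balls *)

Section unweighting.
Variables (R : realType) (b U : nat -> R) (lam l : R).
Hypothesis lam0 : 0 <= lam.
Hypothesis b1 : forall n, 1 <= b n.
Hypothesis U1 : forall n, 1 <= U n.
Hypothesis b_le : forall n, b n <= U n * expR (lam * n%:R).
Hypothesis b_ge : forall m n, (m <= n)%N -> (U n - U m) * expR (lam * m%:R) <= b n.
Hypothesis cvU : ln (U n) / n%:R @[n --> \oo] --> l.

Let b0 n : 0 < b n. Proof. exact: lt_le_trans (b1 n). Qed.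
Let U0 n : 0 < U n. Proof. exact: lt_le_trans (U1 n). Qed.

Lemma ln_ball_le n : (0 < n)%N -> ln (b n) / n%:R <= ln (U n) / n%:R + lam.
Proof.
move=> n0; have nR : 0 < n%:R :> R by rewrite ltr0n.
rewrite ler_pdivrMr // mulrDl divfK ?gt_eqF //.
rewrite -[X in _ + X]expRK -lnM ?posrE ?expR_gt0 // ler_ln ?posrE //.
by rewrite mulr_gt0 ?expR_gt0.
Qed.

(** As [U] grows exponentially, the last [n / K] radii carry half of [U n];
    there the weights are within a factor [expR (lam * n / K)] of the
    smallest one. *)
Lemma ln_ball_ge (e : R) : 0 < e -> 0 < l ->
  \forall n \near \oo, l + lam - e <= ln (b n) / n%:R.
Proof.
move=> e0 l0.
have [K K2 Ke] : exists2 K : nat, (2 <= K)%N & lam / K%:R <= e / 3.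
  exists (Num.trunc (lam / (e / 3))).+2 => //.
  rewrite ler_pdivrMr ?ltr0n // mulrC -ler_pdivrMr ?divr_gt0 //.
  apply: le_trans (ltW (truncnS_gt _)) _; by rewrite ler_nat.
have KR : 2 <= K%:R :> R by rewrite ler_nat.
have K0 : 0 < K%:R :> R by lra.
(* With this precision for [ln (U n) / n] the gap [ln (U n) - ln (U m)] is at
   least [l / (2 * K) * n], up to a constant. *)
pose dl := Num.min (e / 3) (l / (4 * K%:R)).
have dl0 : 0 < dl by rewrite lt_min !divr_gt0 // mulr_gt0.
have [N _ hN] : \forall n \near \oo, `|l - ln (U n) / n%:R| <= dl.
  by move/cvgrPdist_le : cvU; exact.
have [N1 hN1] : exists N1 : nat, (2 * l + ln 2) * (2 * K%:R) / l + ln 2 / (e / 3)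
    < N1.+1%:R by eexists; exact: truncnS_gt.
have ln20 : 0 < ln 2 :> R by rewrite ln_gt0 // ltr1n.
exists (maxn (2 * N.+1) N1.+1) => // n /=; rewrite geq_max => /andP[nN nN1].
have n0 : (0 < n)%N by lia.
have nR : 0 < n%:R :> R by rewrite ltr0n.
pose m := (n - n %/ K)%N.
have nK2 : (n %/ K <= n %/ 2)%N by exact: leq_div2l.
have nK : (n %/ K <= n)%N by exact: leq_div.
have mN : (N <= m)%N by rewrite /m; move: nK2 nN; clear; lia.
have m0 : (0 < m)%N by rewrite /m; move: nK2 nN; clear; lia.
have mR : 0 < m%:R :> R by rewrite ltr0n.
have mn : (m <= n)%N by rewrite leq_subr.
have mE : m%:R = n%:R - (n %/ K)%:R :> R by rewrite /m natrB.
have q1 : (n %/ K)%:R <= n%:R / K%:R :> R.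
  by rewrite ler_pdivlMr // -natrM ler_nat leq_trunc_div.
have q2 : n%:R / K%:R - 1 <= (n %/ K)%:R :> R.
  rewrite lerBlDr ler_pdivrMr // natr1 -natrM ler_nat ltnW // ltn_ceil //.
  exact: leq_trans K2.
have an : (l - dl) * n%:R <= ln (U n).
  have /hN : (N <= n)%N by exact: leq_trans mn.
  by rewrite ler_norml -ler_pdivlMr // => /andP[]; lra.
have am : ln (U m) <= (l + dl) * m%:R.
  by have /hN := mN; rewrite ler_norml -ler_pdivrMr // => /andP[]; lra.
have dlK : dl * K%:R <= l / 4.
  rewrite -ler_pdivlMr // /dl ge_min; apply/orP; right.
  by rewrite invfM mulrA.
set Q : R := n%:R / K%:R in q1 q2.
have QE : Q * K%:R = n%:R by rewrite divfK ?gt_eqF.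
have Q0 : 0 < Q by rewrite divr_gt0.
have bigQ : 2 * l + ln 2 <= l / 2 * Q.
  have : (2 * l + ln 2) * (2 * K%:R) / l <= n%:R.
    apply: le_trans (le_trans (ltW hN1) _); last by rewrite ler_nat.
    by rewrite lerDl divr_ge0 ?ltW // divr_gt0.
  rewrite ler_pdivrMr // -QE => h.
  by rewrite -(ler_pM2r (mulr_gt0 (ltr0n _ 2) K0)) -?[_.+1]/2%N; lra.
have gap : ln (U m) + ln 2 <= ln (U n).
  have : (l + dl) * m%:R <= (l + dl) * (n%:R - Q + 1).
    by rewrite ler_wpM2l ?mE; lra.
  have : dl * n%:R <= l / 4 * Q.
    by rewrite -QE mulrCA [leRHS]mulrC ler_wpM2l // ltW.
  have : dl <= l / 4.
    by apply: le_trans dlK; rewrite -[leLHS]mulr1 ler_wpM2l ?ltW //; lra.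
  have : 0 <= dl * Q by rewrite mulr_ge0 // ltW.
  by move: an am bigQ l0; lra.
have Umn : U m <= U n / 2.
  rewrite ler_pdivlMr // -ler_ln ?posrE ?mulr_gt0 // lnM ?posrE //.
have bn : ln (U n) - ln 2 + lam * m%:R <= ln (b n).
  rewrite -ln_div ?posrE // -[X in _ + X]expRK -lnM ?posrE ?expR_gt0 ?divr_gt0 //.
  rewrite ler_ln ?posrE ?mulr_gt0 ?expR_gt0 ?divr_gt0 //.
  by apply: le_trans (b_ge mn); rewrite ler_pM2r ?expR_gt0 //; lra.
have ln2n : ln 2 <= e / 3 * n%:R.
  rewrite mulrC -ler_pdivrMr ?divr_gt0 //.
  apply: le_trans (le_trans (ltW hN1) _); last by rewrite ler_nat.
  by rewrite lerDr divr_ge0 ?mulr_ge0 ?ltW // addr_gt0 // mulr_gt0.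
have lamQ : lam * Q <= e / 3 * n%:R.
  by rewrite /Q mulrCA mulrC ler_wpM2r // ltW.
have dle : dl <= e / 3 by rewrite ge_min lexx.
have dln : dl * n%:R <= e / 3 * n%:R by rewrite ler_wpM2r // ltW.
have lamm : lam * (n%:R - Q) <= lam * m%:R.
  by rewrite ler_wpM2l // mE; lra.
rewrite ler_pdivlMr //.
by move: bn ln2n lamQ dln lamm an; lra.
Qed.

(** For trivial weights, the case [lam = 0], [b] is squeezed between 1 and
    [U]. *)
Lemma ln_ball_cvg : 0 < l \/ l = 0 /\ lam = 0 ->
  ln (b n) / n%:R @[n --> \oo] --> l + lam.
Proof.
move=> hl; apply/cvgrPdist_le => e e0.
have low : \forall n \near \oo, l + lam - e <= ln (b n) / n%:R.
  case: hl => [l0|[-> ->]]; first exact: ln_ball_ge.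
  apply: nearW => n; rewrite addr0 sub0r.
  by apply: (@le_trans _ _ 0); rewrite ?oppr_le0 ?(ltW e0) // divr_ge0 ?ln_ge0.
have up : \forall n \near \oo, ln (b n) / n%:R <= l + lam + e.
  have /cvgrPdist_le/(_ _ e0) h := cvU.
  near=> n; apply: le_trans (ln_ball_le _) _; first by near: n; exists 1%N.
  have : `|l - ln (U n) / n%:R| <= e by near: n.
  by rewrite ler_norml => /andP[]; lra.
by near=> n; rewrite ler_norml; apply/andP; split; [
  have : ln (b n) / n%:R <= l + lam + e by near: n|
  have : l + lam - e <= ln (b n) / n%:R by near: n]; lra.
Unshelve. all: by end_near. Qed.

End unweighting.

(** * Functions determined by balls *)

Definition rooted (G : graph) (x : vertex G) : mgraph 0 := MGraph [tuple x].

Lemma rootedK (G : mgraph 0) : rooted (Defs.root G) = G.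
Proof.
case: G => G t; rewrite /rooted /Defs.root /=; congr MGraph; apply: val_inj => /=.
by case: (tupleP t) => a s; rewrite (tuple0 s) theadE.
Qed.

Definition root1 (G : mgraph 1) : vertex G := thead (Defs.roots G).
Definition root2 (G : mgraph 1) : vertex G := thead (behead_tuple (Defs.roots G)).

Lemma rball_rooted (G : graph) (x y : vertex G) k :
  rball (rooted x) k y <-> (dist x y <= k)%N.
Proof.
split=> [[r]|xy]; first by rewrite /= inE => /eqP -> /vball_dist.
by exists x; [exact: mem_head|exact/vball_dist].
Qed.

(** [ball_iso] with the isomorphism made explicit, to let it act on further
    vertices. *)
Definition ball_iso_by m k (A B : mgraph m) (f : vertex A -> vertex B) :=
  [/\ set_bij (rball A k) (rball B k) f,
      {in rball A k &, {mono f : x y / adj x y}} &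
      map f (Defs.roots A) = Defs.roots B].

Lemma rball_trans m m' (A : mgraph m) (s : m'.+1.-tuple (vertex A)) j k :
  {in tval s, forall r, rball A j r} ->
  rball (MGraph s) k `<=` rball A (j + k).
Proof.
move=> sj y [r /sj[a aA ar] ry]; exists a => //; apply/vball_dist.
move: ar ry => /vball_dist ar /vball_dist ry.
exact: leq_trans (dist_triangle r a y) (leq_add ar ry).
Qed.

(** Walks of length [k] from the new roots stay in the old ball, where [f] and
    its inverse preserve adjacency. *)
Lemma ball_iso_reroot m m' (A B : mgraph m) (f : vertex A -> vertex B)
    (s : m'.+1.-tuple (vertex A)) (j k M : nat) :
  ball_iso_by M f -> {in tval s, forall r, rball A j r} -> (j + k <= M)%N ->
  @ball_iso_by m' k (MGraph s) (MGraph (map_tuple f s)) f.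
Proof.
move=> [fbij fadj fr] sj jkM.
have [g [gbij gadj gr fK gK]] := ball_iso_inv fbij fadj fr.
have jM : (j <= M)%N by apply: leq_trans jkM; exact: leq_addr.
have fsj : {in tval (map_tuple f s), forall r, rball B j r}.
  by move=> _ /mapP[r rs ->]; apply: rball_homo fadj fr jM _ (sj _ rs).
have AM y : rball (MGraph s) k y -> y \in rball A M.
  by move=> /(rball_trans sj)/(rball_le jkM) h; exact/mem_set.
have BM y : rball (MGraph (map_tuple f s)) k y -> y \in rball B M.
  by move=> /(rball_trans fsj)/(rball_le jkM) h; exact/mem_set.
have fadj' : {in rball (MGraph s) k &, {mono f : x y / adj x y}}.
  by move=> x y /set_mem xs /set_mem ys; apply: fadj; exact: AM.
have gadj' : {in rball (MGraph (map_tuple f s)) k &, {mono g : x y / adj x y}}.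
  by move=> x y /set_mem xs /set_mem ys; apply: gadj; exact: BM.
have gfs : map g (map f s) = s.
  rewrite -map_comp -[RHS]map_id; apply/eq_in_map => x xs /=.
  by apply/fK/mem_set; exact: rball_le jM _ (sj _ xs).
split=> //; split.
- move=> y; exact: (@rball_homo m' (MGraph s) (MGraph (map_tuple f s)) k k).
- by move=> x y /set_mem xs /set_mem ys e; rewrite -(fK x) ?AM // e fK ?AM.
- move=> y ys; exists (g y); last by apply/gK/BM.
  by apply: (@rball_homo m' (MGraph (map_tuple f s)) (MGraph s) k k) ys.
Qed.

(** [f] and its inverse carry geodesics between [x] and [y] to walks. *)
Lemma dist_reroot m (A B : mgraph m) (f : vertex A -> vertex B) (x y : vertex A)
    (j k M : nat) : ball_iso_by M f -> (j + k <= M)%N -> rball A j x ->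
  (dist x y <= k)%N -> dist (f x) (f y) = dist x y.
Proof.
move=> hf jkM xj xyk.
have sj : {in [tuple x], forall r, rball A j r} by move=> r; rewrite inE => /eqP ->.
have [fbij fadj fr] := ball_iso_reroot hf sj jkM.
have [g [gbij gadj gr fK gK]] := ball_iso_inv fbij fadj fr.
have h1 : (dist (f x) (f y) <= dist x y)%N.
  apply/rball_rooted.
  by apply: (@rball_homo 0 (rooted x) (rooted (f x)) k) fadj fr xyk _ _; exact/rball_rooted.
apply/eqP; rewrite eqn_leq h1 /=; apply/rball_rooted.
suff : rball (rooted x) (dist (f x) (f y)) (g (f y)).
  by rewrite fK //; apply/mem_set/rball_rooted.
apply: (@rball_homo 0 (rooted (f x)) (rooted x) k) gadj gr _ _ _.
  exact: leq_trans h1 xyk.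
exact/rball_rooted.
Qed.

Section locality.
Variables (R : realType) (r : R).

Definition local N (h : forall G : graph, vertex G -> R) :=
  forall (G H : graph) (x : vertex G) (y : vertex H),
    ball_iso N (rooted x) (rooted y) -> h G x = h H y.

Lemma local_le M N h : (M <= N)%N -> local M h -> local N h.
Proof. by move=> MN hM G H x y xy; apply/hM/ball_iso_le/xy. Qed.

Lemma local_comp N (phi : R -> R) h : local N h -> local N (fun G x => phi (h G x)).
Proof. by move=> hN G H x y xy; rewrite (hN _ _ _ _ xy). Qed.

Lemma local_comp2 N (phi : R -> R -> R) h h' : local N h -> local N h' ->
  local N (fun G x => phi (h G x) (h' G x)).
Proof. by move=> hN hN' G H x y xy; rewrite (hN _ _ _ _ xy) (hN' _ _ _ _ xy). Qed.

Lemma local_reroot m N h (A B : mgraph m) (f : vertex A -> vertex B) j M x :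
  local N h -> ball_iso_by M f -> (j + N <= M)%N -> rball A j x ->
  h A x = h B (f x).
Proof.
move=> hN hf jNM xj; apply: hN; exists f.
have sj : {in [tuple x], forall r, rball A j r} by move=> a; rewrite inE => /eqP ->.
exact: (ball_iso_reroot hf sj jNM).
Qed.

(** An isomorphism of the balls of radius [n + N] around two roots matches the
    index sets of the sums, the distances to the roots, and the [N]-balls
    around corresponding vertices. *)
Lemma local_ball_sum N n h : local N h ->
  local (n + N) (fun G => ball_sum r n (@h G)).
Proof.
move=> hN G H x x' iso; have [f hf] : exists f : vertex G -> vertex H,
  @ball_iso_by 0 (n + N) (rooted x) (rooted x') f by [].
have [_ _ [fx]] := hf; move: hf; rewrite -fx => {x' fx iso} hf.
have nM : (0 + n <= n + N)%N by rewrite add0n leq_addr.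
have x0 : rball (rooted x) 0 x by apply/rball_rooted; rewrite distxx.
have fd y : y \in fball x n -> dist (f x) (f y) = dist x y.
  by rewrite in_fball => yn; exact: (dist_reroot hf nM x0).
have [fbij fadj fr] := hf.
have [g [gbij gadj gr fK gK]] := ball_iso_inv fbij fadj fr.
have xM y : y \in fball x n -> y \in rball (rooted x) (n + N).
  by rewrite in_fball => yn; apply/mem_set/rball_rooted/(leq_trans yn)/leq_addr.
have ballE : fball (f x) n = [fset f y | y in fball x n]%fset.
  apply/fsetP => z; apply/idP/imfsetP => /= [|[y yn ->]]; last first.
    by rewrite in_fball fd // -in_fball.
  rewrite in_fball => zn; exists (g z); last first.
    by rewrite gK //; apply/mem_set/rball_rooted/(leq_trans zn)/leq_addr.
  rewrite in_fball; apply/rball_rooted.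
  apply: (@rball_homo 0 (rooted (f x)) (rooted x) (n + N) n) gadj gr _ _ _.
    exact: leq_addr.
  exact/rball_rooted.
rewrite /ball_sum ballE big_imfset /=; last first.
  by move=> y z yn zn e; rewrite -(fK y) ?xM // e fK ?xM.
rewrite big_seq [RHS]big_seq; apply: eq_bigr => y yn; rewrite fd //; congr (_ * _).
apply: (local_reroot hN hf (leqnn _)); apply/rball_rooted.
by rewrite -in_fball.
Qed.

(** The mass that the first root sends to the second one, in the transport that
    exchanges [ball_sum n h] and the product of [h] with [ball_sum n 1]. *)
Definition kernel n (h : forall G : graph, vertex G -> R) (A : mgraph 1) : R :=
  if (dist (root1 A) (root2 A) <= n)%N
  then r ^+ dist (root1 A) (root2 A) * h A (root2 A) else 0.

Lemma kernel_ball_iso N n h (A B : mgraph 1) : local N h ->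
  ball_iso (n + N) A B -> kernel n h A = kernel n h B.
Proof.
move=> hN; wlog suff hle : A B / ball_iso (n + N) A B ->
    (dist (root1 A) (root2 A) <= n)%N -> (dist (root1 B) (root2 B) <= n)%N /\
    kernel n h A = kernel n h B.
  move=> AB; have [/(hle _ _ AB)[]//|nA] := boolP (dist (root1 A) (root2 A) <= n)%N.
  rewrite /kernel (negbTE nA); case: ifP => // /(hle _ _ (ball_iso_sym AB))[].
  by rewrite (negbTE nA).
move=> [f hf] An; have [_ _ fr] := hf.
have r1A : root1 A \in tval (Defs.roots A) by exact: mem_tnth.
have r2A : root2 A \in tval (Defs.roots A) by exact/mem_behead/mem_tnth.
have [f1 f2] : root1 B = f (root1 A) /\ root2 B = f (root2 A).
  move: fr; rewrite /root1 /root2; clear.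
  move: (Defs.roots A) (Defs.roots B) => s t.
  case: (tupleP s) => a1 s'; case: (tupleP s') => a2 s''; rewrite (tuple0 s'').
  case: (tupleP t) => b1 t'; case: (tupleP t') => b2 t''; rewrite (tuple0 t'').
  by move=> [<- <-].
have x0 : rball A 0 (root1 A) by exact: rball_root.
have fd : dist (root1 B) (root2 B) = dist (root1 A) (root2 A).
  by rewrite f1 f2; apply: (dist_reroot hf _ x0 An); rewrite add0n leq_addr.
rewrite /kernel fd An; split => //; congr (_ * _); rewrite f2.
apply: (@local_reroot _ _ _ _ _ _ 0 _ _ hN hf (leq_addl _ _)).
exact: rball_root.
Qed.

End locality.

(** * Measurability and mass transport *)

(** A function of the [k]-ball is locally constant, so that all preimages are
    open. *)
Lemma measurable_ball_iso (R : realType) m k (F : mgraph m -> \bar R) :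
  (forall A B, ball_iso k A B -> F A = F B) ->
  measurable_fun setT (fun t : borel (gspace R m) => F (repr (t : gspace R m))).
Proof.
move=> Fk _ Y _; rewrite setTI.
suff : @open (gspace R m) [set t | Y (F (repr t))] by exact: sub_sigma_algebra.
rewrite openE => /= t Yt; apply/nbhs_ballP.
exists k.+1%:R^-1; first by rewrite /= invr_gt0 ltr0n.
move=> u; rewrite ballEmdist /= => tu.
have [|_ [->|[j tuj <-]]] := @inf_lt _ (gdist_set t u) k.+1%:R^-1 _ tu.
- by exists 1; left.
- by rewrite ltNge invf_le1 ?ltr0n // ler1n.
rewrite ltf_pV2 ?posrE ?ltr0n // ltr_nat ltnS => /ltnW kj.
by rewrite -(Fk _ _ (ball_iso_le kj tuj)).
Qed.

Section mass_transport.
Variables (R : realType) (dsp : measure_display) (Omega : measurableType dsp).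
Variables (P : probability Omega R) (X : {RV P >-> borel (gspace R 0)}).
Variables (r : R) (r_ge0 : 0 <= r).
Implicit Types h : forall G : graph, vertex G -> R.

Definition at_root h (w : Omega) : R := h (rep (X w)) (Defs.root (rep (X w))).

Lemma measurable_at_root N h : local N h ->
  measurable_fun setT (fun w => (at_root h w)%:E).
Proof.
move=> hN; pose F (A : mgraph 0) : \bar R := (h A (Defs.root A))%:E.
have mF : measurable_fun setT
    (fun t : borel (gspace R 0) => F (repr (t : gspace R 0))).
  apply: (@measurable_ball_iso R 0 N) => A B AB; congr _%:E; apply: hN.
  by rewrite !rootedK.
exact: measurableT_comp mF (measurable_funPT X).
Qed.

Lemma kernel_pi n N h (A : mgraph 1) : local N h ->
  kernel r n h (repr (\pi_(gspace R 1) A)) = kernel r n h A.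
Proof.
move=> hN; apply: (kernel_ball_iso r hN); apply: iso_ball_iso.
have /eqmodP/asboolP// : repr (\pi_(gspace R 1) A) = A %[mod gspace R 1].
by rewrite reprK.
Qed.

Lemma esum_ball (G : graph) (x : vertex G) n (u : vertex G -> R) :
  (forall y, 0 <= u y) ->
  \esum_(y in [set: vertex G]) (if (dist x y <= n)%N then u y else 0)%:E =
  (\sum_(y <- fball x n) u y)%:E.
Proof.
move=> u0.
transitivity (\esum_(y in vball x n) (u y)%:E).
  rewrite [RHS]esum_mkcond; apply: eq_esum => y _; rewrite -in_fball /fball in_fset_set //.
    by case: ifP.
  exact: finite_vball.
rewrite esum_fset; [|exact: finite_vball|by move=> y _; rewrite lee_fin].
by rewrite fsbig_finite ?sumEFin //; exact: finite_vball.
Qed.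

(** As [dist] is symmetric, a vertex [o] sends [ball_sum n h] and receives the
    multiple [h o] of the sum of its weights. *)
Lemma mass_transport n N h : unimodular X -> local N h ->
  (forall G x, 0 <= h G x) ->
  (\int[P]_w (at_root (fun G x => h G x * ball_sum r n (fun=> 1) x) w)%:E < +oo)%E ->
  (\int[P]_w (at_root (fun G => ball_sum r n (@h G)) w)%:E =
   \int[P]_w (at_root (fun G x => h G x * ball_sum r n (fun=> 1) x) w)%:E)%E.
Proof.
move=> uX hN h0.
pose F (t : borel (gspace R 1)) : \bar R := (kernel r n h (repr (t : gspace R 1)))%:E.
have mF : measurable_fun setT F.
  apply: (@measurable_ball_iso R 1 (n + N) (fun A => (kernel r n h A)%:E)) => A B AB.
  by congr _%:E; exact: kernel_ball_iso AB.
have F0 t : (0 <= F t)%E.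
  by rewrite lee_fin /kernel; case: ifP => // _; rewrite mulr_ge0 ?exprn_ge0.
have outE w : mass_out F (X w) = (at_root (fun G => ball_sum r n (@h G)) w)%:E.
  rewrite /mass_out /at_root /ball_sum -esum_ball; last first.
    by move=> y; rewrite mulr_ge0 ?exprn_ge0.
  by apply: eq_esum => y _; rewrite /F (kernel_pi _ _ hN).
have inE w : mass_in F (X w) =
    (at_root (fun G x => h G x * ball_sum r n (fun=> 1) x) w)%:E.
  rewrite /mass_in /at_root /ball_sum mulr_sumr -esum_ball; last first.
    by move=> y; rewrite !mulr_ge0 ?exprn_ge0.
  apply: eq_esum => y _; rewrite /F (kernel_pi _ _ hN) /kernel /root1 /root2 /=.
  by rewrite !theadE distC mulr1 mulrC.
have := uX F mF F0.
rewrite (eq_integral _ _ (fun w _ => outE w)) (eq_integral _ _ (fun w _ => inE w)).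
by move=> h1 h2; apply: h1; right.
Qed.

End mass_transport.

(** * Jensen's inequality and almost sure polynomial bounds *)

Section power_means.
Variables (R : realType) (r : R) (r0 : 0 < r) (G : graph) (n : nat).
Implicit Types (u : vertex G -> R) (x : vertex G).

Lemma ball_sum_gt0 u x : (forall y, 0 < u y) -> 0 < ball_sum r n u x.
Proof.
move=> u0; apply: lt_le_trans (u0 x) _.
by apply: ball_sum_center => [|y]; exact: ltW.
Qed.

Lemma ball_sum_tangent u x (a b : R) (phi : R -> R) :
  (forall y, a - b * u y <= phi (u y)) ->
  a * ball_sum r n (fun=> 1) x - b * ball_sum r n u x
    <= ball_sum r n (fun y => phi (u y)) x.
Proof.
move=> h; rewrite -!ball_sumZ -sumrB; apply: ler_sum => y _.
by rewrite -mulrBr mulr1 ler_wpM2l // exprn_ge0 // ltW.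
Qed.

(** Jensen's inequality for [t^-1], by its tangent at the mean [S / W]. *)
Lemma ball_sum_inv u x : (forall y, 0 < u y) ->
  ball_sum r n (fun=> 1) x ^+ 2 / ball_sum r n u x
    <= ball_sum r n (fun y => (u y)^-1) x.
Proof.
move=> u0; have S0 := ball_sum_gt0 x u0.
set W := ball_sum r n (fun=> 1) x; set S := ball_sum r n u x in S0 *.
pose c := W / S.
have -> : W ^+ 2 / S = 2 * c * W - c ^+ 2 * S.
  have cS : c * S = W by rewrite divfK // gt_eqF.
  by rewrite expr2 -mulrA -/c -cS; lra.
apply: (@ball_sum_tangent u x _ _ (fun t => t^-1)) => y.
rewrite -[leRHS]mul1r ler_pdivlMr //.
by have := sqr_ge0 (c * u y - 1); lra.
Qed.

(** Jensen's inequality for [(Num.sqrt t)^-1], by its tangent at the mean. *)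
Lemma ball_sum_inv_sqrt u x : (forall y, 0 < u y) ->
  ball_sum r n (fun=> 1) x * Num.sqrt (ball_sum r n (fun=> 1) x / ball_sum r n u x)
    <= ball_sum r n (fun y => (Num.sqrt (u y))^-1) x.
Proof.
move=> u0; have S0 := ball_sum_gt0 x u0.
have W0 := @ball_sum_gt0 (fun=> 1) x (fun=> ltr01).
set W := ball_sum r n (fun=> 1) x in W0 *; set S := ball_sum r n u x in S0 *.
set c := Num.sqrt (W / S).
have c0 : 0 <= c by exact: sqrtr_ge0.
have cS : c ^+ 2 * S = W by rewrite sqr_sqrtr ?divfK ?gt_eqF ?divr_ge0 ?ltW.
have -> : W * c = 3 / 2 * c * W - c ^+ 3 / 2 * S.
  by rewrite exprS -cS; lra.
apply: (@ball_sum_tangent u x _ _ (fun t => (Num.sqrt t)^-1)) => y.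
have v0 : 0 < Num.sqrt (u y) by rewrite sqrtr_gt0.
rewrite -{1}[u y]sqr_sqrtr ?(ltW (u0 y)) //; move: (Num.sqrt (u y)) v0 => v v0.
rewrite -[leRHS]mul1r ler_pdivlMr //.
have : 0 <= (c * v - 1) ^+ 2 * (c * v + 2).
  by rewrite mulr_ge0 ?sqr_ge0 // addr_ge0 // mulr_ge0 // ltW.
by lra.
Qed.

End power_means.

Section polynomial_bound.
Variables (R : realType) (dsp : measure_display) (Omega : measurableType dsp).
Variable P : probability Omega R.

Lemma sum_inv_pronic n :
  \sum_(0 <= i < n) (i.+1 * i.+2)%:R^-1 = 1 - n.+1%:R^-1 :> R.
Proof.
elim: n => [|n IH]; first by rewrite big_nil invr1 subrr.
rewrite big_nat_recr //= IH; set x : R := n.+1%:R; set y : R := n.+2%:R.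
have x0 : 0 < x by rewrite ltr0n.
have y0 : 0 < y by rewrite ltr0n.
have xy : y = x + 1 by rewrite /y natr1.
rewrite natrM invfM -/x -/y.
have h1 : x^-1 * (y * y^-1) = x^-1 by rewrite divff ?mulr1 // gt_eqF.
have h2 : y^-1 * (x * x^-1) = y^-1 by rewrite divff ?mulr1 // gt_eqF.
by move: (x^-1) (y^-1) h1 h2 => a b; rewrite xy; lra.
Qed.

(** The series of the [g n / ((n + 1) * (n + 2))] has a finite integral, so it
    converges almost surely, and its sum serves as [C]. *)
Lemma ae_pronic_bound (g : nat -> Omega -> R) :
  (forall n w, 0 <= g n w) ->
  (forall n, measurable_fun setT (fun w => (g n w)%:E)) ->
  (forall n, \int[P]_w (g n w)%:E <= 1)%E ->
  \forall w \ae P, exists C, forall n, g n w <= C * (n.+1 * n.+2)%:R.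
Proof.
move=> g0 mg g1.
pose f n w : \bar R := ((n.+1 * n.+2)%:R^-1%:E * (g n w)%:E)%E.
have f0 n w : (0 <= f n w)%E by rewrite mule_ge0 ?lee_fin ?invr_ge0.
have mf n : measurable_fun setT (f n) by exact: measurable_funeM.
pose S w : \bar R := (\sum_(n <oo) f n w)%E.
have S0 w : (0 <= S w)%E by exact: nneseries_ge0.
have intS : P.-integrable setT S.
  apply/integrableP; split; first exact: ge0_emeasurable_sum.
  under eq_integral do rewrite gee0_abs //.
  rewrite integral_nneseries //.
  apply: (@le_lt_trans _ _ 1%E); last by rewrite ltry.
  apply: lime_le; first by apply: is_cvg_nneseries => n _ _; exact: integral_ge0.
  apply: nearW => n.
  apply: (@le_trans _ _ (\sum_(0 <= i < n) ((i.+1 * i.+2)%:R^-1 : R)%:E)%E).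
    apply: lee_sum => i _; rewrite ge0_integralZl //; last by move=> w _; rewrite lee_fin.
    by rewrite -[leRHS]mule1 lee_wpmul2l // lee_fin invr_ge0.
  by rewrite sumEFin sum_inv_pronic lee_fin lerBlDr lerDl invr_ge0.
have := integrable_ae measurableT intS.
apply: filterS => w /(_ I) Sw; exists (fine (S w)) => n.
rewrite -ler_pdivrMr ?ltr0n // -lee_fin fineK //.
have -> : ((g n w / (n.+1 * n.+2)%:R)%:E = f n w)%E by rewrite /f -EFinM mulrC.
apply: le_trans (@nneseries_lim_ge R (fun n => f n w) xpredT 0 n.+1 _) => //.
by rewrite big_nat_recr //= leeDr // sume_ge0.
Qed.

End polynomial_bound.

(** * Expectations of the ratios *)

Section expectations.
Variables (R : realType) (dsp : measure_display) (Omega : measurableType dsp).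
Variables (P : probability Omega R) (X : {RV P >-> borel (gspace R 0)}).
Hypothesis uX : unimodular X.
Variables (r : R) (r0 : 0 < r) (n : nat).

Definition sum1 (G : graph) : vertex G -> R := ball_sum r n (fun=> 1).
Definition sum2 (G : graph) : vertex G -> R := ball_sum r n (@sum1 G).
Definition sum3 (G : graph) : vertex G -> R := ball_sum r n (@sum2 G).

Lemma sum1_gt0 G x : 0 < @sum1 G x. Proof. exact: ball_sum_gt0. Qed.
Lemma sum2_gt0 G x : 0 < @sum2 G x.
Proof. by apply: ball_sum_gt0 => // y; exact: sum1_gt0. Qed.
Lemma sum3_gt0 G x : 0 < @sum3 G x.
Proof. by apply: ball_sum_gt0 => // y; exact: sum2_gt0. Qed.

Lemma local_sums : [/\ local (n + (n + (n + 0))) (@sum1),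
  local (n + (n + (n + 0))) (@sum2) & local (n + (n + (n + 0))) (@sum3)].
Proof.
have l0 : local 0 (fun (G : graph) (_ : vertex G) => 1 : R) by [].
have l1 := @local_ball_sum R r _ n _ l0; have l2 := @local_ball_sum R r _ n _ l1.
have l3 := @local_ball_sum R r _ n _ l2.
by split=> //; [apply: local_le l1|apply: local_le l2]; lia.
Qed.

(** These ratios measure how far the second and the third power fall short of
    the square and of the cube of the first one; the square root in
    [cube_ratio] is what makes its integral bounded. *)
Definition sq_ratio G (x : vertex G) := sum1 x ^+ 2 / sum2 x.
Definition cube_ratio G (x : vertex G) := sum1 x * Num.sqrt (sum1 x / sum3 x).

Lemma measurable_ratios :
  measurable_fun setT (fun w => (at_root X sq_ratio w)%:E) /\
  measurable_fun setT (fun w => (at_root X cube_ratio w)%:E).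
Proof.
have [l1 l2 l3] := local_sums.
have lq : local (n + (n + (n + 0))) (@sq_ratio).
  exact: (@local_comp2 _ _ (fun a b => a ^+ 2 / b)).
have lc : local (n + (n + (n + 0))) (@cube_ratio).
  exact: (@local_comp2 _ _ (fun a b => a * Num.sqrt (a / b))).
by split; [exact: measurable_at_root lq|exact: measurable_at_root lc].
Qed.

Lemma ratios_ge0 G (x : vertex G) : 0 <= sq_ratio x /\ 0 <= cube_ratio x.
Proof.
split; first by rewrite divr_ge0 ?exprn_ge0 ?ltW ?sum1_gt0 ?sum2_gt0.
by rewrite mulr_ge0 ?sqrtr_ge0 // ltW // sum1_gt0.
Qed.

(** By Jensen's inequality [sq_ratio] is at most [ball_sum n h] for
    [h = 1 / sum1], and mass transport turns the latter into [h * sum1 = 1]. *)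
Lemma integral_sq_ratio : (\int[P]_w (at_root X sq_ratio w)%:E <= 1)%E.
Proof.
have [l1 _ _] := local_sums.
pose h G (x : vertex G) := (sum1 x)^-1.
have lh : local (n + (n + (n + 0))) h by exact: (local_comp GRing.inv).
have h0 G x : 0 <= h G x by rewrite invr_ge0 ltW // sum1_gt0.
have E w : at_root X (fun G x => h G x * ball_sum r n (fun=> 1) x) w = 1.
  by rewrite /at_root /h mulVf // gt_eqF // sum1_gt0.
have int1 : (\int[P]_w (at_root X (fun G x => h G x * ball_sum r n (fun=> 1) x) w)%:E
    = 1)%E.
  under eq_integral do rewrite E.
  by rewrite integral_cst // mul1e; exact: probability_setT.
rewrite -[leRHS]int1 -(mass_transport (ltW r0) uX lh h0); last first.
  by rewrite int1 ltry.
apply: ge0_le_integral => //.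
- by move=> w _; rewrite lee_fin; case: (ratios_ge0 (Defs.root (rep (X w)))).
- by have [] := measurable_ratios.
- by apply: measurable_at_root; exact: local_ball_sum lh.
- move=> w _; rewrite lee_fin; apply: ball_sum_inv => // y; exact: sum1_gt0.
Qed.

(** By Jensen's inequality [cube_ratio] is at most [ball_sum n h] for
    [h = 1 / sqrt sum2]; mass transport turns the latter into
    [sum1 / sqrt sum2], the square root of [sq_ratio]. *)
Lemma integral_cube_ratio : (\int[P]_w (at_root X cube_ratio w)%:E <= 1)%E.
Proof.
have [l1 l2 _] := local_sums.
pose h G (x : vertex G) := (Num.sqrt (sum2 x))^-1.
have lh : local (n + (n + (n + 0))) h.
  exact: (local_comp (fun a => (Num.sqrt a)^-1)).
have h0 G x : 0 <= h G x by rewrite invr_ge0 sqrtr_ge0.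
have lhs : local (n + (n + (n + 0))) (fun G x => h G x * ball_sum r n (fun=> 1) x).
  exact: local_comp2.
have int1 : (\int[P]_w (at_root X (fun G x => h G x * ball_sum r n (fun=> 1) x) w)%:E
    <= 1)%E.
  apply: (@le_trans _ _ (\int[P]_w ((1 + at_root X sq_ratio w) / 2)%:E)%E).
    apply: ge0_le_integral => //.
    - move=> w _; rewrite lee_fin /at_root mulr_ge0 //; apply: ltW; exact: sum1_gt0.
    - exact: measurable_at_root lhs.
    - have lsq : local (n + (n + (n + 0))) (fun G x => (1 + @sq_ratio G x) / 2).
        exact: (@local_comp2 _ _ (fun a b => (1 + a ^+ 2 / b) / 2)).
      exact: measurable_at_root lsq.
    - move=> w _; rewrite lee_fin /at_root /sq_ratio /h -/(sum1 _).
      set x := Defs.root _; have a0 := sum1_gt0 x; have b0 := sum2_gt0 x.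
      rewrite -[sum2 x in leRHS]sqr_sqrtr ?(ltW b0) // -expr_div_n mulrC.
      by have := sqr_ge0 (sum1 x / Num.sqrt (sum2 x) - 1); lra.
  have E w : ((1 + at_root X sq_ratio w) / 2)%:E =
      (2^-1%:E * (1 + (at_root X sq_ratio w)%:E))%E.
    by rewrite -EFinD -EFinM mulrC.
  have msq := measurable_ratios.1.
  have sq0 w : (0 <= (at_root X sq_ratio w)%:E)%E.
    by rewrite lee_fin; case: (ratios_ge0 (Defs.root (rep (X w)))).
  under eq_integral do rewrite E.
  rewrite ge0_integralZl //=; last first.
  - by move=> w _; rewrite adde_ge0.
  - by apply: emeasurable_funD => //; exact: measurable_cst.
  rewrite ge0_integralD // integral_cst // mul1e.
  rewrite [X in (_ * (X + _))%E](_ : _ = 1%E); last exact: probability_setT.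
  rewrite -[leRHS](_ : 2^-1%:E * (1 + 1) = 1)%E.
    by rewrite lee_pmul2l // ?lte_fin // leeD2l // integral_sq_ratio.
  by rewrite -EFinD -EFinM mulVf.
apply: (le_trans _ int1); rewrite -(mass_transport (ltW r0) uX lh h0); last first.
  by apply: le_lt_trans int1 _; rewrite ltry.
apply: ge0_le_integral => //.
- by move=> w _; rewrite lee_fin; case: (ratios_ge0 (Defs.root (rep (X w)))).
- by have [] := measurable_ratios.
- by apply: measurable_at_root; exact: local_ball_sum lh.
- move=> w _; rewrite lee_fin; apply: ball_sum_inv_sqrt => // y; exact: sum2_gt0.
Qed.

End expectations.

(** * Growth of unimodular random trees *)

Section tree_growth.
Variables (R : realType) (G : graph) (o : vertex G) (q : nat).
Hypotheses (treeG : is_tree G) (q0 : (0 < q)%N) (deg : degree_le G q.+1).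

Let s : R := Num.sqrt q%:R.
Let r : R := s^-1.
Let U n : R := sum1 r n o.
Let b n : R := #|` fball o n|%:R.
Let lam : R := ln s.

Let s1 : 1 <= s. Proof. by rewrite /s -[leLHS]sqrtr1; apply: ler_wsqrtr; rewrite ler1n. Qed.
Let s0 : 0 < s. Proof. exact: lt_le_trans s1. Qed.
Let r0 : 0 < r. Proof. by rewrite invr_gt0. Qed.
Let r1 : r <= 1. Proof. by rewrite invf_le1. Qed.
Let rq : r ^+ 2 * q%:R <= 1.
Proof. by rewrite exprVn sqr_sqrtr // mulVf // pnatr_eq0 -lt0n. Qed.
Let lam0 : 0 <= lam. Proof. exact: ln_ge0. Qed.
Let expR_lam n : expR (lam * n%:R) = s ^+ n.
Proof. by rewrite expRM_natr lnK. Qed.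

Let UE n : U n = \sum_(y <- fball o n) r ^+ dist o y.
Proof. by apply: eq_bigr => y _; rewrite mulr1. Qed.

Let bE n : b n = \sum_(y <- fball o n) 1.
Proof. by rewrite /b -sum1_size natr_sum. Qed.

Let ball_sub m n : (m <= n)%N -> (fball o m `<=` fball o n)%fset.
Proof. by move=> mn; apply/fsubsetP => y; rewrite !in_fball => /leq_trans; apply. Qed.

Let U_split m n : (m <= n)%N ->
  U n = U m + \sum_(y <- (fball o n `\` fball o m)%fset) r ^+ dist o y.
Proof.
move=> mn; rewrite !UE (big_fsetID _ (mem (fball o m))) /=; congr (_ + _).
  apply: eq_fbigl => y; rewrite !inE /=; apply/andP/idP => [[]//|ym].
  by split => //; exact: (fsubsetP (ball_sub mn)).
by apply: eq_fbigl => y; rewrite !inE /= andbC.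
Qed.

Let U_homo : {homo U : m n / (m <= n)%N >-> m <= n}.
Proof.
move=> m n mn; rewrite (U_split mn) lerDl sumr_ge0 // => y _.
by rewrite exprn_ge0 // ltW.
Qed.

Let U1 n : 1 <= U n.
Proof. by apply: (ball_sum_center n o (ltW r0)) => y; exact: ler01. Qed.

Let U0 n : 0 < U n. Proof. exact: lt_le_trans (U1 n). Qed.

Let b1 n : 1 <= b n.
Proof.
rewrite /b ler1n cardfs_gt0; apply/fset0Pn; exists o.
by rewrite in_fball distxx.
Qed.

(** The radius [n] has the smallest weight, [s ^- n]. *)
Let b_le n : b n <= U n * expR (lam * n%:R).
Proof.
rewrite expR_lam UE bE mulr_suml big_seq [leRHS]big_seq; apply: ler_sum => y.
rewrite in_fball => yn; rewrite -(subnK yn) exprD mulrC -mulrA -exprMn.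
by rewrite divff ?gt_eqF // expr1n mulr1 exprn_ege1.
Qed.

(** The weights beyond radius [m] are at most [s ^- m]. *)
Let b_ge m n : (m <= n)%N -> (U n - U m) * expR (lam * m%:R) <= b n.
Proof.
move=> mn; rewrite (U_split mn) addrC addKr expR_lam mulr_suml.
apply: (@le_trans _ _ (\sum_(y <- (fball o n `\` fball o m)%fset) 1)).
  rewrite big_seq [leRHS]big_seq; apply: ler_sum => y.
  rewrite inE !in_fball -ltnNge => /andP[ym _].
  rewrite -(subnK (ltnW ym)) exprD -mulrA -exprMn mulVf ?gt_eqF // expr1n mulr1.
  by rewrite exprn_ile1 // ltW.
rewrite -(natr_sum R _ _ (fun=> 1%N)) sum1_size ler_nat; apply: fsubset_leq_card.
exact: fsubsetDl.
Qed.

Let card_ball_le n : (#|` fball o n| <= (2 * q.+1) ^ n)%N.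
Proof.
elim: n => [|n IH].
  apply: (@uniq_leq_size _ _ [:: o]) => [|y]; first exact: fset_uniq.
  by rewrite in_fball leqn0 inE => /eqP/dist_eq0 ->.
have : (fball o n.+1 `<=` fball o n `|` sphere o n.+1)%fset.
  apply/fsubsetP => y; rewrite in_fsetU !in_fball in_sphere leq_eqVlt orbC ltnS.
  by [].
move=> /fsubset_leq_card h; apply: (leq_trans h); rewrite cardfsU.
apply: leq_trans (leq_subr _ _) _.
apply: leq_trans (leq_add IH (card_sphere o n.+1 q0 deg)) _.
have qn : (q ^ n <= (2 * q.+1) ^ n)%N.
  by case: n {IH h} => // n; rewrite leq_exp2r // mulnC; lia.
by rewrite !expnS; move: qn; clear; nia.
Qed.

Let ln_U_le n : ln (U n) <= ln (2 * q.+1)%:R * n%:R.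
Proof.
rewrite mulr_natr -lnXn ?ltr0n ?muln_gt0 // ler_ln ?posrE ?exprn_gt0 ?ltr0n //.
apply: (@le_trans _ _ (b n)); last by rewrite -natrX ler_nat.
rewrite UE bE; apply: ler_sum => y _; rewrite exprn_ile1 // ltW //.
Qed.

Section scaling.
Variable C : R.
Hypothesis C1 : 1 <= C.
Hypothesis sqC : forall n, sq_ratio r n o <= C * (n.+1 * n.+2)%:R.
Hypothesis cubeC : forall n, cube_ratio r n o <= C * (n.+1 * n.+2)%:R.

Let sum2_le n x : @sum2 R r n G x <= (2 * (n + n).+1 * n.+1)%:R * sum1 r (n + n) x.
Proof. exact: (ball_sum_comp n n x treeG q0 deg r0 r1 rq). Qed.

Let sum3_le n : @sum3 R r n G o <=
  ((2 * (n + n).+1 * n.+1) * (2 * (n + (n + n)).+1 * n.+1))%:R * U (3 * n).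
Proof.
apply: (@le_trans _ _ (ball_sum r n
    (fun y => (2 * (n + n).+1 * n.+1)%:R * sum1 r (n + n) y) o)).
  apply: ler_ball_sum => [|y]; [exact: ltW|exact: sum2_le].
rewrite ball_sumZ [in leRHS]natrM -mulrA ler_wpM2l //.
have -> : (3 * n = n + (n + n))%N by clear; lia.
exact: (ball_sum_comp n (n + n) o treeG q0 deg r0 r1 rq).
Qed.

Let C0 : 0 < C. Proof. exact: lt_le_trans C1. Qed.

(** The polynomial factors here and in [U_triple] come from the hypotheses and
    from one, resp. two, uses of [ball_sum_comp]; both are at most
    [96 * (n + 1) ^ 8]. *)
Let U_double n : U n ^+ 2 <= C ^+ 2 * (n.+1%:R ^+ 8 * 96) * U (2 * n).
Proof.
have := sqC n; rewrite /sq_ratio ler_pdivrMr ?sum2_gt0 // => /le_trans; apply.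
have -> : (2 * n = n + n)%N by clear; lia.
apply: le_trans (ler_wpM2l _ (sum2_le n o)) _; first by rewrite mulr_ge0 ?ltW.
rewrite [leLHS]mulrA ler_wpM2r ?(ltW (U0 _)) // -[leLHS]mulrA -natrM.
apply: ler_pM; rewrite ?(ltW C0) ?ler0n //.
  by rewrite expr2 -[leLHS]mulr1 ler_wpM2l // ltW.
rewrite -natrX -natrM ler_nat.
have h1 : (n.+1 * n.+2 <= 2 * n.+1 ^ 2)%N by clear; nia.
have h2 : (2 * (n + n).+1 * n.+1 <= 4 * n.+1 ^ 2)%N by clear; nia.
apply: leq_trans (leq_mul h1 h2) _.
rewrite mulnACA -expnD mulnC leq_mul //; exact: leq_pexp2l.
Qed.

Let U_triple n : U n ^+ 3 <= C ^+ 2 * (n.+1%:R ^+ 8 * 96) * U (3 * n).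
Proof.
have S0 := sum3_gt0 r0 n o; have V0 := U0 n.
have : cube_ratio r n o ^+ 2 <= (C * (n.+1 * n.+2)%:R) ^+ 2.
  by rewrite ler_pXn2r ?nnegrE // ?mulr_ge0 ?sqrtr_ge0 ?ltW.
rewrite /cube_ratio exprMn sqr_sqrtr; last by rewrite divr_ge0 ?ltW.
rewrite [sum1 r n o ^+ 2 * _]mulrA -exprSr ler_pdivrMr // => /le_trans; apply.
apply: le_trans (ler_wpM2l _ (sum3_le n)) _; first by rewrite exprn_ge0 // mulr_ge0 ?ltW.
rewrite [leLHS]mulrA ler_wpM2r ?(ltW (U0 _)) // exprMn -[leLHS]mulrA.
apply: ler_wpM2l; first by rewrite exprn_ge0 // ltW.
rewrite -!natrX -!natrM ler_nat.
have h1 : (n.+1 * n.+2 <= 2 * n.+1 ^ 2)%N by clear; nia.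
have h2 : (2 * (n + n).+1 * n.+1 <= 4 * n.+1 ^ 2)%N by clear; nia.
have h3 : (2 * (n + (n + n)).+1 * n.+1 <= 6 * n.+1 ^ 2)%N by clear; nia.
have h4 : ((n.+1 * n.+2) ^ 2 <= 4 * n.+1 ^ 4)%N.
  apply: (@leq_trans ((2 * n.+1 ^ 2) ^ 2)); first by rewrite leq_exp2r.
  by rewrite expnMn -expnM.
apply: leq_trans (leq_mul h4 (leq_mul h2 h3)) _.
by rewrite [(4 * _ * (6 * _))%N]mulnACA mulnACA -!expnD mulnC.
Qed.

Let D := ln (C ^+ 2 * 96) + 32.

Let lnC0 : 0 <= ln (C ^+ 2 * 96).
Proof.
by apply/ln_ge0/mulr_ege1; [exact: exprn_ege1|rewrite ler1n].
Qed.

(** The logarithm of a polynomial in [n] is below any positive power of [n];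
    [scaling_limit] asks for the square root. *)
Let log_error n : (0 < n)%N -> ln (C ^+ 2 * (n.+1%:R ^+ 8 * 96)) <= D * Num.sqrt n%:R.
Proof.
move=> n0; set t := Num.sqrt n%:R.
have t1 : 1 <= t by rewrite /t -[leLHS]sqrtr1; apply: ler_wsqrtr; rewrite ler1n.
have t0 : 0 < t by exact: lt_le_trans t1.
have tn : t ^+ 2 = n%:R by rewrite sqr_sqrtr.
have C20 : 0 < C ^+ 2 * 96 by rewrite mulr_gt0 ?exprn_gt0.
have lnN : ln n.+1%:R <= 4 * t.
  apply: (@le_trans _ _ (ln ((2 * t) ^+ 2))).
    rewrite ler_ln ?posrE ?exprn_gt0 ?mulr_gt0 // exprMn tn -natrX -natrM ler_nat.
    by move: n0; clear; lia.
  rewrite lnXn ?mulr_gt0 // mulr2n.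
  have := expR_ge1Dx (ln (2 * t)); rewrite lnK ?posrE ?mulr_gt0 //; lra.
rewrite [_ * 96]mulrC [C ^+ 2 * (_ * _)]mulrA.
rewrite lnM ?posrE ?exprn_gt0 // lnXn // -[ln n.+1%:R *+ 8]mulr_natl /D [leRHS]mulrDl.
apply: lerD; last by move: lnN; lra.
by rewrite -[leLHS]mulr1 ler_wpM2l // lnC0.
Qed.

Lemma ln_weighted_ball_cvg :
  exists2 l : R, 0 <= l & ln (U n) / n%:R @[n --> \oo] --> l.
Proof.
apply: (@scaling_limit R (fun n => ln (U n)) (ln (2 * q.+1)%:R) D) => //.
- by move=> n; exact: ln_ge0.
- by move=> m n mn; rewrite ler_ln ?posrE // U_homo.
- by rewrite addr_ge0.
- move=> k n; rewrite !inE => k23 n0; rewrite lerBlDr.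
  apply: (@le_trans _ _ (ln (U (k * n)) + ln (C ^+ 2 * (n.+1%:R ^+ 8 * 96)))); last first.
    by rewrite lerD2l; exact: log_error.
  have E0 : 0 < C ^+ 2 * (n.+1%:R ^+ 8 * 96).
    by rewrite !mulr_gt0 ?exprn_gt0 ?ltr0n // (lt_le_trans _ C1).
  rewrite mulr_natl -lnXn // -lnM ?posrE // ler_ln ?posrE ?exprn_gt0 ?mulr_gt0 //.
  rewrite [leRHS]mulrC.
  by case/orP: k23 => /eqP ->; [exact: U_double|exact: U_triple].
Qed.

End scaling.

Let powRE n : (0 < n)%N -> b n `^ n%:R^-1 = expR (ln (b n) / n%:R).
Proof. by move=> n0; rewrite /powR gt_eqF ?(lt_le_trans _ (b1 n)) // mulrC. Qed.

(** When the weighted balls grow subexponentially, [b n] is at most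
    [s ^ n] up to a subexponential factor. *)
Let limsup_le : ln (U n) / n%:R @[n --> \oo] --> 0 ->
  (limn_esup (fun n => (b n `^ n%:R^-1)%:E) <= s%:E)%E.
Proof.
move=> cv0; apply/lee_addgt0Pr => e e0.
have cve : expR (ln (U n) / n%:R + lam) @[n --> \oo] --> s.
  rewrite -[X in _ --> X](lnK (s0 : s \is Num.pos)) -/lam -[lam in X in _ --> X]add0r.
  apply: continuous_cvg; first exact: continuous_expR.
  by apply: cvgD => //; exact: cvg_cst.
have /cvgrPdist_le/(_ _ e0)[N _ hN] := cve.
rewrite /limn_esup limf_esupE; apply: le_trans (ereal_inf_lbound _) _.
  by exists [set n | (N.+1 <= n)%N] => //; exists N.+1.
apply: ge_ereal_sup => _ [n Nn <-]; have n0 : (0 < n)%N by exact: leq_trans Nn.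
rewrite -EFinD lee_fin powRE //.
apply: (@le_trans _ _ (expR (ln (U n) / n%:R + lam))).
  by rewrite ler_expR; exact: (ln_ball_le b1 U1 b_le).
by have := hN n (ltnW Nn); rewrite ler_norml => /andP[+ _]; lra.
Qed.

Lemma growth_cvg (l : R) : 0 <= l -> ln (U n) / n%:R @[n --> \oo] --> l ->
  (q = 1)%N \/ (s%:E < limn_esup (fun n => (b n `^ n%:R^-1)%:E))%E ->
  cvgn (fun n => b n `^ n%:R^-1).
Proof.
move=> l0 cvl hq.
have hl : 0 < l \/ l = 0 /\ lam = 0.
  move: l0; rewrite le_eqVlt => /predU1P[l0|]; last by left.
  right; split=> //; case: hq => [qE|]; first by rewrite /lam /s qE sqrtr1 ln1.
  by rewrite ltNge limsup_le // l0.
have cvb := ln_ball_cvg lam0 b1 U1 b_le b_ge cvl hl.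
apply/cvg_ex; exists (expR (l + lam)).
have : expR (ln (b n) / n%:R) @[n --> \oo] --> expR (l + lam).
  by apply: continuous_cvg => //; exact: continuous_expR.
apply: cvg_trans; apply: near_eq_cvg; exists 1%N => // n /= n0.
by rewrite powRE.
Qed.

End tree_growth.

Theorem theorem1 (R : realType) (dsp : measure_display)
    (Omega : measurableType dsp) (P : probability Omega R) (d : nat)
    (T : {RV P >-> borel (rooted_graphs R)})
    (d_gt0 : (0 < d)%N)
    (T_unimodular : unimodular T)
    (T_tree : \forall w \ae P, is_tree (rep (T w)))
    (T_degree : \forall w \ae P, degree_le (rep (T w)) d)
    (T_growth : \forall w \ae P,
      ((Num.sqrt (d%:R - 1))%:E < limn_esup (fun n => (growth R (rep (T w)) n)%:E))%E) :
  \forall w \ae P, cvgn (growth R (rep (T w))).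
Proof.
(* The maximum with 1 covers [d = 1], where the weights are trivial. *)
pose q := maxn d.-1 1; have q0 : (0 < q)%N by rewrite leq_max orbT.
pose r : R := (Num.sqrt q%:R)^-1.
have r0 : 0 < r by rewrite invr_gt0 sqrtr_gt0 ltr0n.
have ge0 n w := ratios_ge0 r0 n (Defs.root (rep (T w))).
have sqC : \forall w \ae P, exists C, forall n,
    at_root T (@sq_ratio R r n) w <= C * (n.+1 * n.+2)%:R.
  apply: ae_pronic_bound => [n w|n|n].
  - by have [] := ge0 n w.
  - by have [] := measurable_ratios T r0 n.
  - exact: integral_sq_ratio.
have cubeC : \forall w \ae P, exists C, forall n,
    at_root T (@cube_ratio R r n) w <= C * (n.+1 * n.+2)%:R.
  apply: ae_pronic_bound => [n w|n|n].
  - by have [] := ge0 n w.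
  - by have [] := measurable_ratios T r0 n.
  - exact: integral_cube_ratio.
near=> w.
have [C1 hC1] : exists C, forall n,
    at_root T (@sq_ratio R r n) w <= C * (n.+1 * n.+2)%:R by near: w.
have [C2 hC2] : exists C, forall n,
    at_root T (@cube_ratio R r n) w <= C * (n.+1 * n.+2)%:R by near: w.
have tree : is_tree (rep (T w)) by near: w.
have degd : degree_le (rep (T w)) d by near: w.
have deg : degree_le (rep (T w)) q.+1.
  move=> x; apply: card_le_trans (degd x) _; rewrite card_le_II /q.
  by move: d_gt0; clear; lia.
pose C := Num.max 1 (Num.max C1 C2).
have hC (c : R) n : c <= Num.max C1 C2 -> c * (n.+1 * n.+2)%:R <= C * (n.+1 * n.+2)%:R.
  by move=> cC; rewrite ler_wpM2r // le_max cC orbT.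
have C_ge1 : 1 <= C by rewrite le_max lexx.
have sqw n : sq_ratio r n (Defs.root (rep (T w))) <= C * (n.+1 * n.+2)%:R.
  by apply: le_trans (hC1 n) (hC _ _ _); rewrite le_max lexx.
have cubew n : cube_ratio r n (Defs.root (rep (T w))) <= C * (n.+1 * n.+2)%:R.
  by apply: le_trans (hC2 n) (hC _ _ _); rewrite le_max lexx orbT.
have [l l0 cvl] := ln_weighted_ball_cvg tree q0 deg C_ge1 sqw cubew.
apply: (growth_cvg q0 l0 cvl).
have [d2|d1] := leqP 2 d; last first.
  by left; rewrite /q; move: d1 d_gt0; clear; lia.
right; have -> : q%:R = d%:R - 1 :> R.
  have -> : q = (d - 1)%N by rewrite /q; move: d2; clear; lia.
  by rewrite natrB.
by near: w.
Unshelve. all: by end_near. Qed.
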